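(* Let $\mu\in\mathbb{R}$, $T>0$ and $x^*=(z,y)\in D^*=\{(z,y)\in\mathbb{R}^2:z<y\}$ be fixed. Then: (a) For any continuous sample path $X=(X(t))_{0\le t\le T}$ in $\mathbb{R}$, $X^*(T)=\Psi^*_T(x^*,X)$ satisfies $\Gamma(x^*,X(0))=\Gamma(X^*(T),X(T))$. (b) Let $W$ be a standard one-dimensional Brownian motion started at $0$, let $x\in\mathbb{R}$, let $\hat X(s)=x-\mu s+W(s)$ for $0\le s\le T$, and let $\hat X(T-\cdot)=(\hat X(T-t))_{0\le t\le T}$. Then $\Psi^*_T(x^*,\hat X(T-\cdot))$ has the same distribution as $X^*_W(T)$, where $X^*_W(t)=(z+\mu t+W(t),\,y+\mu t-W(t))$ until the first time $t$ at which its two coordinates coincide, and $X^*_W$ equals a coffin state from that time on.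
   Context: For a continuous path $X=(X(t))_{0\le t\le T}$ in $\mathbb{R}$, set $\omega(t)=X(t)-X(0)-\mu t$, $0\le t\le T$. If $y\ge X(0)$, set $L(t)=-\min_{0\le v\le t}\big([y-X(0)-2\omega(v)]\wedge 0\big)$. Define the path $$\tilde\Theta_{y,T}(X)=\begin{cases}(-\omega(t))_{0\le t\le T} & \text{if } X(0)>y,\\ (\omega(t)-L(t))_{0\le t\le T} & \text{if } y\ge X(0).\end{cases}$$ The map $\Psi^*_T((z,y),X)$ is defined as follows: for $0\le t\le T$ set $Y(t)=y+\mu t-\tilde\Theta_{y,T}(X)(t)$, $Z(t)=z+\mu t+\tilde\Theta_{y,T}(X)(t)$, and $\zeta=\inf\{t\ge 0: Z(t)=Y(t)\}$; then $\Psi^*_T((z,y),X)=(Z(T),Y(T))$ if $T<\zeta$, and it is a coffin state if $T\ge\zeta$. The duality function is $\Gamma((z,y),x)=1$ if $z<x\le y$ and $0$ otherwise, extended by $\Gamma=0$ when the first argument is the coffin state. *)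

(* Defs.v *)
From HB Require Import structures.
From mathcomp Require Import all_boot all_order all_algebra.
From mathcomp Require Import all_classical all_reals all_analysis.
Import Order.TTheory GRing.Theory Num.Theory.
Import numFieldNormedType.Exports.

Set Implicit Arguments.
Unset Strict Implicit.
Unset Printing Implicit Defensive.

Local Open Scope classical_set_scope.
Local Open Scope ring_scope.

(* The state space with a coffin state: [option T], with [None] the coffin
   state. Its sigma-algebra is that of the disjoint union of [T] and [{None}]. *)
Section option_measurable.
Context d (T : measurableType d).

Definition measurable_option : set (set (option T)) :=
  [set B | measurable (Some @^-1` B)].

Lemma measurable_option0 : measurable_option set0.
Proof. by rewrite /measurable_option /= preimage_set0; exact: measurable0. Qed.

Lemma measurable_optionC (B : set (option T)) :
  measurable_option B -> measurable_option (~` B).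
Proof.
by rewrite /measurable_option /= => mB; rewrite preimage_setC; exact: measurableC.
Qed.

Lemma measurable_option_bigcup (F : (set (option T))^nat) :
  (forall i, measurable_option (F i)) -> measurable_option (\bigcup_i F i).
Proof.
move=> mF; rewrite /measurable_option /= preimage_bigcup.
exact: bigcupT_measurable.
Qed.

HB.instance Definition _ := @isMeasurable.Build d (option T)
  measurable_option measurable_option0 measurable_optionC
  measurable_option_bigcup.

End option_measurable.

(* The law of a random element only makes sense when the latter is measurable,
   so measurability of both maps is part of the notion. *)
Definition same_distribution d d' (Om : measurableType d)
    (E : measurableType d') (R : realType) (P : probability Om R)
    (X X' : Om -> E) : Prop :=
  [/\ measurable_fun [set: Om] X, measurable_fun [set: Om] X' &
      forall B : set E, measurable B -> pushforward P X B = pushforward P X' B].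

Section brownian_motion.
Context d (Om : measurableType d) (R : realType) (P : probability Om R).

(* Mutual independence: the product rule for subfamilies is the case where some
   of the [B i] are the whole line. *)
Definition mutually_independent n (X : 'I_n -> Om -> R) : Prop :=
  forall B : 'I_n -> set R, (forall i, measurable (B i)) ->
    P (\bigcap_(i in [set: 'I_n]) (X i @^-1` B i)) =
    (\prod_(i < n) P (X i @^-1` B i))%E.

(* [normal_prob] takes the standard deviation as its second parameter. The
   random variables [W t] with [t < 0] play no role. *)
Record standard_brownian_motion (W : R -> {RV P >-> R}) : Prop := {
  brownian_start : forall w, W 0 w = 0 ;
  brownian_continuous :
    forall w, {within `[0, +oo[, continuous (fun t => W t w)} ;
  brownian_increment : forall s t, 0 <= s -> s < t ->
    forall B, measurable B ->
      pushforward P (fun w => W t w - W s w) B =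
      normal_prob 0 (Num.sqrt (t - s)) B ;
  brownian_independent : forall n (t : nat -> R), 0 <= t 0%N ->
    {homo t : i j / (i <= j)%N >-> i <= j} ->
    mutually_independent (fun (i : 'I_n) w => W (t i.+1) w - W (t i) w)
}.

End brownian_motion.

(* A path indexed by an interval of times is a total function [R -> R] of which
   only the values on that interval are used. *)
Section duality_maps.
Context {R : realType}.
Implicit Types (mu T t s x y : R) (X w : R -> R) (xs : R * R).

Definition Dstar : set (R * R) := [set xs | xs.1 < xs.2].

Definition omega mu X t : R := X t - X 0 - mu * t.

(* For a continuous path, the infimum over [0, t] is attained. *)
Definition L mu y X t : R :=
  - inf [set Num.min (y - X 0 - 2 * omega mu X v) 0 | v in `[0, t]].

Definition Theta mu y X t : R :=
  if y < X 0 then - omega mu X t else omega mu X t - L mu y X t.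

(* First time in the time set [I] at which two paths meet, [+oo] if none. *)
Definition meeting_time (I : set R) (Z Y : R -> R) : \bar R :=
  ereal_inf [set t%:E | t in [set t | I t /\ Z t = Y t]].

Definition Psi mu T xs X : option (R * R) :=
  let Y t := xs.2 + mu * t - Theta mu xs.2 X t in
  let Z t := xs.1 + mu * t + Theta mu xs.2 X t in
  if (T%:E < meeting_time `[0%R, T] Z Y)%E then Some (Z T, Y T) else None.

Definition Gamma (o : option (R * R)) x : R :=
  if o is Some (z, y) then (if z < x <= y then 1 else 0) else 0.

(* The process [X^*_W] along the sample path [w] of [W]. *)
Definition Xstar mu xs w t : option (R * R) :=
  let Z s := xs.1 + mu * s + w s in
  let Y s := xs.2 + mu * s - w s in
  if (t%:E < meeting_time `[0%R, +oo[ Z Y)%E then Some (Z t, Y t) else None.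

Definition Xhat mu x w s : R := x - mu * s + w s.

Definition time_reversal T X t : R := X (T - t).

End duality_maps.

(* Main.v *)
Require Import Defs.
From mathcomp Require Import all_boot all_order all_algebra.
From mathcomp Require Import all_classical all_reals all_analysis.
From mathcomp Require Import measurable_realfun ring lra.
Import Order.TTheory GRing.Theory Num.Theory.
Import numFieldNormedType.Exports.

Set Implicit Arguments.
Unset Strict Implicit.
Unset Printing Implicit Defensive.

Local Open Scope classical_set_scope.
Local Open Scope ring_scope.

(** Both parts rest on looking at the two dual coordinates relatively to [X].

Pathwise duality. If [X 0 <= y] then, with [Theta = omega - L],
<<
    Y t - X t = (y - X 0) - 2 * omega t + L t
    X t - Z t = (X 0 - z) + L t
>>
where [L] is the running maximum of [2 * omega - (y - X 0)], truncated below at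
[0]. The first quantity is therefore nonnegative, and it vanishes whenever [L]
increases. If [z < X 0] the second one is positive as well, so [Z < X <= Y]
persists and the coordinates never meet. If [X 0 <= z] and still [Z T < X T],
then [L] has exceeded [z - X 0], and the first time at which it gets there is a
meeting time. If [y < X 0] then [Y - X] is constantly [y - X 0], hence negative.
This is [Gamma_Psi].

Law of the dual. Along the reversal of [x - mu * s + W s] one has
[omega t = W (T - t) - W T]; write [v] for [W T], [S] for the maximum of [W] on
[[0, T]], [a] for [y - x + mu * T] and [b] for [(y - z) / 2]. The coordinates
meet exactly when [Theta] reaches [b], so that the claim is that the pair
(endpoint of [Theta], has [Theta] reached [b]?) has the same law as the pair
(endpoint of [W], has [W] reached [b]?). Computing the path functional ([PsiE]):
if [a < v] then [Theta] is [- omega], with endpoint [v]; if [v <= a] then its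
endpoint is the minimum of [- v] and [a - 2 * S], and it stays below [b] if and
only if [S - v < b] or [a - 2 * b < v]. According to its location, the endpoint
is treated in three ways.
 - Above [a]: [Theta] is [- omega], which is itself a Brownian motion.
 - Between [2 * b - a] and [a]: survival forces the endpoint to be that of
   [omega], and survival becomes [max omega < b]; again [omega] is a Brownian
   motion.
 - Below both [a] and [2 * b - a]: on a half-line the event is a difference of
   two events of the form ([v <= x] and [h < S]), whose probabilities the
   reflection principle gives as P(v > 2h - x). The answer,
   P(v < r) - P(v > 2b - r), is also that of P(v < r, S < b) by reflection.
The three are put together in [survives_lt] and [killed_endpoint_law].

Probability. Laws of functionals of Brownian motion are taken through the dyadic
increments: independence and the normal marginals determine the law of the tuple
of increments ([tuple_law_eq]), which makes it invariant under reversal and under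
changes of sign, in particular under flipping the sign of the increments that
follow the first passage of the dyadic skeleton above a level
([passage_reflection]). This plays the part of the strong Markov property: the
skeleton overshoots the level, but by continuity of the paths the overshoot tends
to zero as the mesh does ([small_overshoot]), and the reflection principle
([reflection_gt], [reflection_lt]) follows in the limit. *)

(** * Continuous paths on an interval *)
Section paths.
Context {R : realType}.
Implicit Types (T t s v b c h mu : R) (f w X : R -> R) (xs : R * R).

Lemma within_continuous_lt_near f T t c : {within `[0, T], continuous f} ->
  0 <= t <= T -> f t < c ->
  exists2 d, 0 < d & forall s, 0 <= s <= T -> `|t - s| < d -> f s < c.
Proof.
move=> /subspace_continuousP cf tT ftc.
have /(_ _)/cvgrPdist_lt/(_ (c - f t)) := cf t.
rewrite /= in_itv/= subr_gt0 => /(_ tT ftc).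
rewrite near_withinE => /nbhs_ballP[d /= d0 H]; exists d => // s sT sd.
have := H s sd; rewrite /= in_itv/= => /(_ sT) fts.
have {fts} : `|f t - f s| < c - f t by exact: fts.
by rewrite ltr_norml => /andP[? ?]; lra.
Qed.

(** The infimum of the times at which [f] is at least [c]; were [f] strictly
above [c] there, the intermediate value theorem would give an earlier one. *)
Lemma first_passage f T c v0 : {within `[0, T], continuous f} ->
  f 0 <= c -> 0 <= v0 <= T -> c <= f v0 ->
  exists t, [/\ 0 <= t <= v0, f t = c & forall v, 0 <= v <= t -> f v <= c].
Proof.
move=> cf f0 /andP[v00 v0T] fv0.
pose A := [set t | 0 <= t <= v0 /\ c <= f t].
have A0 : A v0 by rewrite /A/= v00 lexx.
have lbA : lbound A 0 by move=> t [/andP[]].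
have infA : has_inf A by split; [exists v0|exists 0].
have le_inf t : A t -> inf A <= t by move=> At; apply: ge_inf => //; exists 0.
have inf0 : 0 <= inf A by apply: lb_le_inf => //; exists v0.
have infv0 : inf A <= v0 by exact: le_inf.
have fge : c <= f (inf A).
  rewrite leNgt; apply/negP => flt.
  have [|d d0 H] := within_continuous_lt_near cf _ flt; first by lra.
  have [t At] := inf_adherent d0 infA; have := le_inf _ At.
  move=> it td; have := H t; case: At => /andP[t0 tv0] cft.
  rewrite ler0_norm; last by lra.
  by lra.
have fle t : 0 <= t < inf A -> f t <= c.
  move=> /andP[t0 ti]; rewrite leNgt; apply/negP => /ltW ct.
  by have := le_inf t; rewrite /A/= => /(_ (conj _ ct)); lra.
have feq : f (inf A) = c.
  apply/eqP; rewrite eq_le fge andbT leNgt; apply/negP => flt.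
  have cf' : {within `[0, inf A], continuous f}.
    apply: continuous_subspaceW cf => t /=; rewrite !in_itv/=; lra.
  have [|t] := IVT inf0 cf' (v := c).
    by rewrite ge_min le_max f0 (ltW flt) orbT.
  rewrite in_itv/= => tI ftc.
  have := le_inf t; rewrite /A/= ftc lexx => /(_ (conj _ isT)) ti.
  have eti : t = inf A by lra.
  by move: flt; rewrite -eti ftc ltxx.
exists (inf A); split => //; first by rewrite inf0.
move=> v /andP[v0' ]; rewrite le_eqVlt => /predU1P[->|vi]; first by rewrite feq.
by apply: fle; rewrite v0'.
Qed.

Definition runmax T f : R := sup [set f t | t in `[0, T]].

Lemma runmaxP T f : 0 <= T -> {within `[0, T], continuous f} ->
  (exists2 t, 0 <= t <= T & f t = runmax T f) /\
  forall t, 0 <= t <= T -> f t <= runmax T f.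
Proof.
move=> T0 cf; have [t] := EVT_max T0 cf.
rewrite in_itv/= => tT tmax.
have E : runmax T f = f t.
  apply/eqP; rewrite eq_le; apply/andP; split.
    apply: ge_sup; first by exists (f t); exists t => //=; rewrite in_itv.
    by move=> _ [s /= sT <-]; exact: tmax.
  apply: ub_le_sup; last by exists t => //=; rewrite in_itv.
  by exists (f t) => _ [s /= sT <-]; exact: tmax.
split; first by exists t.
by move=> s sT; rewrite E; apply: tmax; rewrite in_itv.
Qed.

(** A path that starts below [b] cannot get above [b] without hitting it, which is
why the absence of a meeting is a statement about a maximum. *)
Lemma level_hitP T f b : 0 <= T -> {within `[0, T], continuous f} -> f 0 < b ->
  (exists t, 0 <= t <= T /\ f t = b) <-> b <= runmax T f.
Proof.
move=> T0 cf f0b; have [[t tT ft] ubf] := runmaxP T0 cf; split.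
  by move=> [s [sT <-]]; exact: ubf.
rewrite -ft => bft.
have [s [sT fs _]] := first_passage cf (ltW f0b) tT bft.
exists s; split => //; move: tT sT; lra.
Qed.

(** The time set is bounded by [T], so that an infimum beyond [T] can only be that
of the empty set. *)
Lemma meeting_timeP T Z Y :
  (T%:E < meeting_time `[0%R, T] Z Y)%E <->
  ~ exists t, 0 <= t <= T /\ Z t = Y t.
Proof.
rewrite /meeting_time; split.
  move=> Tm [t [tT ZY]]; move: Tm; apply/negP; rewrite -leNgt.
  apply: (@le_trans _ _ t%:E); last by rewrite lee_fin; case/andP: tT.
  by apply: ereal_inf_lbound; exists t => //=; rewrite in_itv.
move=> H; rewrite [X in ereal_inf X](_ : _ = set0) ?ereal_inf0 ?ltry//.
rewrite -subset0 => _ [t /= [+ ZY] _]; rewrite in_itv/= => tT.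
by apply: H; exists t.
Qed.

(** On the half-line the infimum could equal [T] without being attained; it
is the continuity of [w] at [T] that excludes it. *)
Lemma meeting_timeyP T w b : 0 <= T -> {within `[0, +oo[, continuous w} ->
  forall Z Y, (forall t, Z t = Y t <-> w t = b) ->
  (T%:E < meeting_time `[0%R, +oo[ Z Y)%E <->
  ~ exists t, 0 <= t <= T /\ w t = b.
Proof.
move=> T0 cw Z Y ZY; rewrite /meeting_time; split.
  move=> Tm [t [tT /ZY wt]]; move: Tm; apply/negP; rewrite -leNgt.
  apply: (@le_trans _ _ t%:E); last by rewrite lee_fin; case/andP: tT.
  apply: ereal_inf_lbound; exists t => //=; split => //.
  by rewrite in_itv/= andbT; case/andP: tT.
move=> H; have wTb : w T != b.
  by apply/eqP => wT; apply: H; exists T; rewrite T0 lexx.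
have [d d0 Hd] : exists2 d, 0 < d & forall t, 0 <= t -> `|T - t| < d -> w t != b.
  move/subspace_continuousP : cw => /(_ T) /=; rewrite in_itv/= andbT => /(_ T0).
  move=> /cvgrPdist_lt/(_ `|w T - b|); rewrite normr_gt0 subr_eq0 => /(_ wTb).
  rewrite near_withinE => /nbhs_ballP[d /= d0 Hd]; exists d => // t t0 td.
  have := Hd t td; rewrite /= in_itv/= andbT => /(_ t0) wTt.
  have {}wTt : `|w T - w t| < `|w T - b| by exact: wTt.
  by apply/eqP => wt; rewrite wt ltxx in wTt.
apply: (@lt_le_trans _ _ (T + d)%:E); first by rewrite lte_fin ltrDl.
apply: le_ereal_inf_tmp => _ [t /= [+ /ZY wt] <-]; rewrite in_itv/= andbT => t0.
rewrite lee_fin leNgt; apply/negP => tTd.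
have tT : T < t.
  by rewrite ltNge; apply/negP => tT; apply: H; exists t; rewrite t0 tT.
have : w t != b by apply: Hd => //; rewrite ltr0_norm ?subr_lt0//; lra.
by rewrite wt eqxx.
Qed.

Lemma omega0 mu X : omega mu X 0 = 0.
Proof. by rewrite /omega; ring. Qed.

Lemma continuous_omega mu X T : {within `[0, T], continuous X} ->
  {within `[0, T], continuous (omega mu X)}.
Proof.
move=> cX; apply: within_continuousB; first apply: within_continuousB => //.
  by apply: continuous_subspaceT => t; exact: cst_continuous.
by apply: continuous_subspaceT => t; exact: mulrl_continuous.
Qed.

(** [L] is defined by an infimum of reals, which is a lower bound only because the
path is bounded below on the interval. *)
Lemma L_ge mu y X T t : {within `[0, T], continuous X} -> 0 <= t <= T ->
  0 <= L mu y X t /\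
  forall v, 0 <= v <= t -> 2 * omega mu X v - (y - X 0) <= L mu y X t.
Proof.
move=> cX tT; rewrite /L; set A := [set _ | _ in _].
have T0 : 0 <= T by move: tT; lra.
have [_ ub] := runmaxP T0 (continuous_omega (mu := mu) cX).
have Age v : 0 <= v <= t ->
    inf A <= Num.min (y - X 0 - 2 * omega mu X v) 0.
  move=> vt; apply: ge_inf; last by exists v => //=; rewrite in_itv.
  exists (Num.min (y - X 0 - 2 * runmax T (omega mu X)) 0) => _ [s /= + <-].
  rewrite in_itv/= => st; rewrite le_min !ge_min lexx orbT andbT; apply/orP; left.
  have /ub : 0 <= s <= T by move: st tT; lra.
  lra.
split.
  have := Age 0; rewrite lexx; have -> : 0 <= t by case/andP: tT.
  by move=> /(_ isT); rewrite le_min => /andP[]; lra.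
by move=> v /Age; rewrite le_min => /andP[]; lra.
Qed.

Lemma L_le mu y X t m : 0 <= t -> 0 <= m ->
  (forall v, 0 <= v <= t -> 2 * omega mu X v - (y - X 0) <= m) ->
  L mu y X t <= m.
Proof.
move=> t0 m0 H; rewrite /L lerNl; apply: lb_le_inf.
  by eexists; exists 0 => //=; rewrite in_itv/= lexx.
move=> _ [s /= + <-]; rewrite in_itv/= => st.
by rewrite le_min; have := H _ st; lra.
Qed.

(** Everything follows from [Y - X] and [X - Z] in terms of [L]; in the only case
where a meeting has to be exhibited, it is the first time at which
[2 * omega - (y - X 0)] reaches [z - X 0]: there [L] takes that value, and
both differences vanish. *)
Lemma Gamma_Psi mu T xs X : 0 < T -> Dstar xs -> {within `[0, T], continuous X} ->
  Gamma (Some xs) (X 0) = Gamma (Psi mu T xs X) (X T).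
Proof.
case: xs => z y T0; rewrite /Dstar/= => zy cX.
have TT : 0 <= T <= T by lra.
rewrite /Psi/=.
set Th := Theta mu y X.
case: (boolP (_ < meeting_time _ _ _)%E) => [/meeting_timeP nohit|/negP hit] /=; last first.
  case: ifP => // /andP[zX Xy]; exfalso; apply: hit.
  apply/meeting_timeP => -[t [tT]]; rewrite /Th /Theta ltNge Xy/=.
  have [L0 /(_ t)] := L_ge mu y cX tT.
  have -> : 0 <= t <= t by lra.
  by move=> /(_ isT); lra.
have [Xy|yX] := leP (X 0) y; last first.
  rewrite andbF /Th /Theta yX /omega ifF//.
  by apply/negbTE; rewrite negb_and -!leNgt -ltNge; apply/orP; right; lra.
rewrite andbT.
have ThE t : Th t = omega mu X t - L mu y X t by rewrite /Th /Theta ltNge Xy.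
have [L0 LT] := L_ge mu y cX TT.
have := LT T; rewrite TT => /(_ isT) LTT.
have omT : omega mu X T = X T - X 0 - mu * T by [].
have [zX|Xz] := ltP z (X 0).
  by rewrite ifT// !ThE; apply/andP; split; lra.
rewrite ifF//; apply/negbTE/negP => /andP[zT Ty]; apply: nohit.
have LTz : z - X 0 < L mu y X T by move: zT; rewrite ThE; lra.
have [v0 v0T v0z] : exists2 v0, 0 <= v0 <= T &
    z - X 0 <= 2 * omega mu X v0 - (y - X 0).
  apply: contrapT => nv; move: LTz; apply/negP; rewrite -leNgt.
  apply: L_le; [lra|lra|move=> v vT].
  by rewrite leNgt; apply/negP => /ltW vz; apply: nv; exists v.
(* [(z + y) / 2 - X 0] is the value of [omega] where [2 * omega - (y - X 0)]
   equals [z - X 0] *)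
have [||t [tv omt omle]] := @first_passage (omega mu X) T ((z + y) / 2 - X 0) v0
    (continuous_omega (mu := mu) cX) _ v0T.
- by rewrite omega0; lra.
- by lra.
have tT : 0 <= t <= T by move: tv v0T; lra.
exists t; split => //; rewrite ThE.
have Lt : L mu y X t = z - X 0.
  apply/eqP; rewrite eq_le; apply/andP; split.
    by apply: L_le => [||v /omle]; lra.
  have [_ /(_ t)] := L_ge mu y cX tT; rewrite omt.
  have -> : 0 <= t <= t by lra.
  by move=> /(_ isT); lra.
by rewrite Lt omt; lra.
Qed.

End paths.

(** * The dual map along a reversed path *)

Section reversed_paths.
Context {R : realType}.
Implicit Types (T t s v b c h mu x y z a : R) (f w X : R -> R) (xs : R * R).

Lemma continuous_time_reversal w T : {within `[0, T], continuous w} ->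
  {within `[0, T], continuous (time_reversal T w)}.
Proof.
move=> /subspace_continuousP cw; apply/subspace_continuousP => t /=.
rewrite in_itv/= => tT; apply/cvgrPdist_lt => e e0.
have := cw (T - t); rewrite /= in_itv/= => /(_ _)/cvgrPdist_lt/(_ e e0).
have -> : 0 <= T - t <= T by lra.
move=> /(_ isT); rewrite near_withinE => /nbhs_ballP[d /= d0 H].
rewrite near_withinE; apply/nbhs_ballP; exists d => //= s sd.
rewrite in_itv/= => sT; apply: (H (T - s)).
  by rewrite /ball/= (_ : T - t - (T - s) = - (t - s)) ?normrN; [|ring].
by rewrite /= in_itv/=; lra.
Qed.

Lemma continuous_Xhat mu x w T : {within `[0, T], continuous w} ->
  {within `[0, T], continuous (Xhat mu x w)}.
Proof.
move=> cw; apply: within_continuousD => //.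
apply: within_continuousB; apply: continuous_subspaceT => t.
  exact: cst_continuous.
exact: mulrl_continuous.
Qed.

Lemma omega_reversal mu x w T t :
  omega mu (time_reversal T (Xhat mu x w)) t = w (T - t) - w T.
Proof. by rewrite /omega /time_reversal /Xhat subr0; ring. Qed.

(** The opposite of [omega] along the reversed path; a Brownian motion when [w]
is one. *)
Definition reversed_increment T w t := w T - w (T - t).

Lemma continuous_reversed_increment w T : {within `[0, T], continuous w} ->
  {within `[0, T], continuous (reversed_increment T w)}.
Proof.
move=> cw; apply: within_continuousB; last exact: continuous_time_reversal.
by apply: continuous_subspaceT => t; exact: cst_continuous.
Qed.

Lemma runmax_unique T f m : 0 <= T -> {within `[0, T], continuous f} ->
  (exists2 t, 0 <= t <= T & f t = m) -> (forall t, 0 <= t <= T -> f t <= m) ->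
  runmax T f = m.
Proof.
move=> T0 cf [t tT ft] H; have [[s sT fs] ub] := runmaxP T0 cf.
by apply/eqP; rewrite eq_le -{1}fs H// -ft ub.
Qed.

Lemma continuous_within_opp w T : {within `[0, T], continuous w} ->
  {within `[0, T], continuous (fun t => - w t)}.
Proof. by move=> cw t; apply: continuousN; exact: cw. Qed.

Lemma runmax_reversed_incrementN w T : 0 <= T -> {within `[0, T], continuous w} ->
  runmax T (fun t => - reversed_increment T w t) = runmax T w - w T.
Proof.
move=> T0 cw; have [[t tT wt] ub] := runmaxP T0 cw.
apply: runmax_unique => //.
- exact/continuous_within_opp/continuous_reversed_increment.
- exists (T - t); first by lra.
  by rewrite /reversed_increment -wt opprB (_ : T - (T - t) = t)//; ring.
- move=> s sT; rewrite /reversed_increment opprB lerD2r; apply: ub; lra.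
Qed.

Lemma XstarE mu T z y w : 0 <= T -> z < y -> {within `[0, +oo[, continuous w} ->
  w 0 = 0 ->
  Xstar mu (z, y) w T = if runmax T w < (y - z) / 2
    then Some (z + mu * T + w T, y + mu * T - w T) else None.
Proof.
move=> T0 zy cw w0; rewrite /Xstar/=.
have cwT : {within `[0, T], continuous w}.
  by apply: continuous_subspaceW cw => t /=; rewrite !in_itv/= andbT => /andP[].
have -> // : (T%:E < meeting_time `[0%R, +oo[ (fun s => z + mu * s + w s)%R
      (fun s => y + mu * s - w s)%R)%E = (runmax T w < (y - z) / 2).
apply/idP/idP.
  move=> /(meeting_timeyP (b := (y - z) / 2) T0 cw)/= H; rewrite ltNge; apply/negP.
  move=> /level_hitP -/(_ T0 cwT) H'; apply: H; last by apply: H'; lra.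
  by move=> t; split; lra.
move=> H; apply/(meeting_timeyP (b := (y - z) / 2) T0 cw) => [t|].
  by split; lra.
by move=> /level_hitP -/(_ T0 cwT); rewrite leNgt H => /(_ _)/notF; apply; lra.
Qed.

(** The value of [Theta] at time [T], as a function of the final value [v] and the
maximum [S] of the path before reversal. *)
Definition endpoint a S v : R := if a < v then v else Num.min (- v) (a - 2 * S).

(** In the second branch [Theta] is [omega - L], whose maximum is the minimum of
[S - w T], the maximum of [omega], and of [(a - w T) / 2]. *)
Definition survives a b T w : bool :=
  if a < w T then runmax T (reversed_increment T w) < b
  else (runmax T w - w T < b) || (a - 2 * b < w T).

(** The case [y < X 0] is [level_hitP] for [- omega]. Otherwise [Theta <= omega] and
[Theta <= (a - w T) / 2], since [L] is at least [0] and at least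
[2 * omega - (a - w T)]. Conversely, if both bounds reach [b], then [omega] hits
[b] for the first time while [L] is still [0], and [Theta] equals [b] there. *)
Lemma PsiE mu T x z y w : 0 <= T -> z < y -> {within `[0, T], continuous w} ->
  w 0 = 0 ->
  let a := y - x + mu * T in
  let e := endpoint a (runmax T w) (w T) in
  Psi mu T (z, y) (time_reversal T (Xhat mu x w)) =
    if survives a ((y - z) / 2) T w then Some (z + mu * T + e, y + mu * T - e)
    else None.
Proof.
move=> T0 zy cw w0 a e; rewrite /Psi/=.
set X := time_reversal _ _.
have cX : {within `[0, T], continuous X}.
  exact/continuous_time_reversal/continuous_Xhat.
have X0 : X 0 = x - mu * T + w T by rewrite /X /time_reversal /Xhat subr0.
have om t : omega mu X t = - reversed_increment T w t.
  by rewrite omega_reversal /reversed_increment opprB.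
have omT : omega mu X T = - w T.
  by rewrite om /reversed_increment subrr w0 subr0.
have r0 : reversed_increment T w 0 = 0 by rewrite /reversed_increment subr0 subrr.
have yX0 : (y < X 0) = (a < w T) by rewrite X0 /a; apply/idP/idP; lra.
have cr := continuous_reversed_increment cw.
have maxom := runmax_reversed_incrementN T0 cw.
have com : {within `[0, T], continuous (omega mu X)} by exact: continuous_omega.
have [[tm tmT omtm] ubom] := runmaxP T0 (continuous_within_opp cr).
rewrite maxom -om in omtm.
have {}ubom t : 0 <= t <= T -> omega mu X t <= runmax T w - w T.
  by rewrite om -maxom; exact: ubom.
have TT : 0 <= T <= T by lra.
have -> : Theta mu y X T = e.
  rewrite /Theta yX0 /e /endpoint; case: ltP => awT; first by rewrite omT opprK.
  have [L0 LT] := L_ge mu y cX TT.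
  have := LT _ tmT; rewrite omtm => LM.
  have LM' m : 0 <= m -> 2 * (runmax T w - w T) - (y - X 0) <= m ->
      L mu y X T <= m.
    by move=> m0 hm; apply: L_le => // v /ubom; lra.
  rewrite omT; rewrite X0 in LM LM'.
  case: leP => h; rewrite /a in h *.
    have := LM' 0 (lexx _); lra.
  have := LM' (2 * (runmax T w - w T) - (y - (x - mu * T + w T))); lra.
have -> // : (T%:E < meeting_time `[0%R, T]
    (fun t => z + mu * t + Theta mu y X t)%R
    (fun t => y + mu * t - Theta mu y X t)%R)%E = survives a ((y - z) / 2) T w.
rewrite /survives; have [awT|awT] := ltP a (w T).
  have ThE t : Theta mu y X t = reversed_increment T w t.
    by rewrite /Theta yX0 awT om opprK.
  apply/idP/idP.
    move=> /meeting_timeP H; rewrite ltNge; apply/negP.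
    move=> /level_hitP -/(_ T0 cr) []; first by rewrite r0; lra.
    by move=> t [tT rt]; apply: H; exists t; split => //; rewrite !ThE rt; lra.
  move=> H; apply/meeting_timeP => -[t [tT]]; rewrite !ThE => rt.
  have /level_hitP -/(_ T0 cr) : exists t, 0 <= t <= T /\
      reversed_increment T w t = (y - z) / 2 by exists t; split => //; lra.
  by rewrite leNgt H r0 => /(_ _)/notF; apply; lra.
have ThE t : Theta mu y X t = omega mu X t - L mu y X t.
  by rewrite /Theta yX0 ltNge awT.
apply/idP/idP.
  move=> /meeting_timeP H; rewrite -[_ || _]negbK negb_or -!leNgt.
  apply/negP => /andP[hS hv]; apply: H.
  have [||t [ttm omt omle]] := @first_passage _ _ T ((y - z) / 2) tm com _ tmT.
  - by rewrite omega0; lra.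
  - by rewrite omtm.
  have tT : 0 <= t <= T by move: ttm tmT; lra.
  exists t; split => //; rewrite ThE.
  have -> : L mu y X t = 0.
    apply/eqP; rewrite eq_le (L_ge mu y cX tT).1 andbT.
    by apply: L_le => [||v /omle]; rewrite ?X0 ?/a; rewrite /a in hv; lra.
  by rewrite omt; lra.
move=> H; apply/meeting_timeP => -[t [tT]]; rewrite !ThE => rt.
have [L0 /(_ t)] := L_ge mu y cX tT.
have -> : 0 <= t <= t by lra.
move=> /(_ isT) Lt; have omt := ubom _ tT.
rewrite X0 in Lt.
by case/orP: H; rewrite /a; lra.
Qed.

End reversed_paths.

(** * Laws of tuples of independent variables *)

Lemma measurable_preimage d d' (E : measurableType d) (F : measurableType d')
    (f : E -> F) C :
  measurable_fun setT f -> measurable C -> measurable (f @^-1` C).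
Proof. by move=> mf mC; rewrite -[X in measurable X]setTI; exact: mf. Qed.

Lemma measurable_event d (E : measurableType d) (f : E -> bool) :
  measurable_fun setT f -> measurable [set w | f w].
Proof.
move=> mf; have -> : [set w | f w] = f @^-1` [set true] by [].
exact: measurable_preimage.
Qed.

Section tuple_law.
Context d (Om : measurableType d) (R : realType) (P : probability Om R).

Definition box n (B : 'I_n -> set R) : set (n.-tuple R) :=
  [set u | forall i, B i (tnth u i)].

Lemma measurable_box n (B : 'I_n -> set R) : (forall i, measurable (B i)) ->
  measurable (box B).
Proof.
move=> mB; have -> : box B = \bigcap_(i in [set: 'I_n]) ((@tnth _ _)^~ i @^-1` B i).
  by apply/seteqP; split => [u Bu i _|u Bu i]; exact: Bu.
apply: fin_bigcap_measurable; first exact: finite_finset.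
by move=> i _; rewrite -[X in measurable X]setTI; exact: measurable_tnth.
Qed.

(** Boxes are stable under intersection, so that laws of tuples need only be
compared on boxes. *)
Lemma tuple_measurableE n :
  @measurable _ (n.-tuple R) =
  <<s [set E | exists2 B : 'I_n -> set R, (forall i, measurable (B i)) & E = box B] >>.
Proof.
apply/seteqP; split; last first.
  apply: smallest_sub; first exact: sigma_algebra_measurable.
  by move=> _ [B mB ->]; exact: measurable_box.
apply: smallest_sub; first exact: smallest_sigma_algebra.
rewrite -bigcup_seq => E [i _ [A mA <-]]; apply: sub_sigma_algebra.
exists (fun j => if j == i then A else setT).
  by move=> j; case: ifP.
apply/seteqP; split => [u [_ Au] j|u /(_ i)]; last by rewrite eqxx.
by case: eqP => [->|].
Qed.

Definition rv_tuple n (X : 'I_n -> Om -> R) (w : Om) : n.-tuple R :=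
  [tuple X i w | i < n].

Lemma measurable_rv_tuple n (X : 'I_n -> Om -> R) :
  (forall i, measurable_fun setT (X i)) -> measurable_fun setT (rv_tuple X).
Proof.
move=> mX; apply/measurable_fun_tnthP => i.
by apply: eq_measurable_fun (mX i) => w _ /=; rewrite tnth_mktuple.
Qed.

(** On boxes, independence reduces the comparison to the marginals. *)
Lemma tuple_law_eq n (X Y : 'I_n -> Om -> R) :
  (forall i, measurable_fun setT (X i)) ->
  (forall i, measurable_fun setT (Y i)) ->
  mutually_independent P X -> mutually_independent P Y ->
  (forall i A, measurable A -> P (X i @^-1` A) = P (Y i @^-1` A)) ->
  forall E, measurable E -> P (rv_tuple X @^-1` E) = P (rv_tuple Y @^-1` E).
Proof.
move=> mX mY iX iY XY E mE.
pose fX : {mfun Om >-> n.-tuple R} :=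
  mfun_Sub (mem_set (measurable_rv_tuple mX)).
pose fY : {mfun Om >-> n.-tuple R} :=
  mfun_Sub (mem_set (measurable_rv_tuple mY)).
have boxE Z (B : 'I_n -> set R) : rv_tuple Z @^-1` box B =
    \bigcap_(i in [set: 'I_n]) (Z i @^-1` B i).
  apply/seteqP; split => [w Bw i _|w Bw i].
    by have := Bw i; rewrite tnth_mktuple.
  by rewrite tnth_mktuple; exact: Bw.
apply: (measure_unique _ (fun=> setT) (tuple_measurableE n) _ _ _
  (pushforward P fX) (pushforward P fY)) => //.
- move=> _ _ [A mA ->] [B mB ->].
  exists (fun i => A i `&` B i); first by move=> i; exact: measurableI.
  apply/seteqP; split => u; first by move=> [Au Bu] i; split.
  by move=> ABu; split => i; have [] := ABu i.
- move=> _; exists (fun=> setT) => //; apply/seteqP; split => //.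
- by rewrite bigcup_const.
- move=> _ [B mB ->]; change (P (rv_tuple X @^-1` box B) = P (rv_tuple Y @^-1` box B)).
  rewrite !boxE iX// iY//.
  by apply: eq_bigr => i _; exact: XY.
- by move=> _; change (P setT < +oo)%E; rewrite probability_setT ltry.
Qed.

End tuple_law.

Section independence.
Context d (Om : measurableType d) (R : realType) (P : probability Om R).

Lemma mutually_independent_comp n (X : 'I_n -> Om -> R) (g : 'I_n -> R -> R) :
  (forall i, measurable_fun setT (g i)) -> mutually_independent P X ->
  mutually_independent P (fun i => g i \o X i).
Proof.
move=> mg iX B mB; rewrite -(iX (fun i => g i @^-1` B i)) // => i.
exact: measurable_preimage.
Qed.

Lemma mutually_independent_reindex n (X : 'I_n -> Om -> R) (s : 'I_n -> 'I_n) :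
  involutive s -> mutually_independent P X ->
  mutually_independent P (fun i => X (s i)).
Proof.
move=> sK iX B mB; transitivity (\prod_(i < n) P (X i @^-1` B (s i)))%E; last first.
  rewrite (reindex s) /=; last by exists s => i _; exact: sK.
  by apply: eq_bigr => i _; rewrite sK.
rewrite -iX//; congr (P _); apply/seteqP; split => [w Bw i _|w Bw i _].
  by have := Bw (s i) I; rewrite /preimage/= sK.
by have := Bw (s i) I; rewrite /preimage/= sK.
Qed.

End independence.

(** * Reflection of a random walk at its first passage *)

Section walk.
Context d (Om : measurableType d) (R : realType) (P : probability Om R).

Definition psum n (u : n.-tuple R) (k : nat) : R :=
  \sum_(i < n | (i < k)%N) tnth u i.

Lemma measurable_psum n k : measurable_fun setT (fun u : n.-tuple R => psum u k).
Proof.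
rewrite /psum; under eq_fun do rewrite big_mkcond/=.
apply: measurable_sum => i; case: (i < k)%N => //; exact: measurable_tnth.
Qed.

(** The walk with increments [u] is above [h] for the first time at step [k]; for
distinct [k] these events are disjoint. *)
Definition passage n h k : set (n.-tuple R) :=
  [set u | h < psum u k /\ forall j, (j < k)%N -> psum u j <= h].
Arguments passage : clear implicits.

Lemma measurable_passage n h k : measurable (passage n h k).
Proof.
rewrite (_ : passage n h k = (fun u => psum u k) @^-1` `]h, +oo[ `&`
    \bigcap_(j in `I_k) ((fun u => psum u j) @^-1` `]-oo, h])).
  apply: measurableI; first exact: (measurable_preimage (measurable_psum _)).
  apply: fin_bigcap_measurable => [|j _].
    exact: finite_II.
  exact: (measurable_preimage (measurable_psum _)).
apply/seteqP; split => u /=; rewrite in_itv/= andbT => -[hu ju]; split => //.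
Qed.

Lemma passage_inj n h k l (u : n.-tuple R) : passage n h k u -> passage n h l u ->
  k = l.
Proof.
rewrite /passage/= => -[hk jk] [hl jl].
case: (ltngtP k l) => // [/jl|/jk] le_h.
  by have := lt_le_trans hk le_h; rewrite ltxx.
by have := lt_le_trans hl le_h; rewrite ltxx.
Qed.

Lemma passage_exists n h (u : n.-tuple R) m : h < psum u m ->
  exists2 k, (k <= m)%N & passage n h k u.
Proof.
move=> hm; have ex : exists k, h < psum u k by exists m.
exists (ex_minn ex); first by case: ex_minnP => k _; exact.
case: ex_minnP => k hk kmin; split => // j jk.
by rewrite leNgt; apply/negP => /kmin; rewrite leqNgt jk.
Qed.

Variables (n : nat) (X : 'I_n -> Om -> R).
Hypothesis mX : forall i, measurable_fun setT (X i).
Hypothesis iX : mutually_independent P X.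
Hypothesis symX : forall i A, measurable A -> P (X i @^-1` A) = P ((-%R \o X i) @^-1` A).

Let mflip k (i : 'I_n) : measurable_fun setT (if (i < k)%N then id else -%R : R -> R).
Proof. by case: ifP. Qed.

Definition flip k (i : 'I_n) : Om -> R := (if (i < k)%N then id else -%R) \o X i.

(** Changing the sign of an increment does not change its law, and keeps
independence. *)
Lemma flip_law k E : measurable E ->
  P (rv_tuple X @^-1` E) = P (rv_tuple (flip k) @^-1` E).
Proof.
apply: tuple_law_eq => //.
- by move=> i; apply: measurableT_comp.
- exact: (mutually_independent_comp (mflip k)).
- by move=> i A mA; rewrite /flip; case: ifP => // _; exact: symX.
Qed.

Lemma psum_flip k j w : (j <= k)%N ->
  psum (rv_tuple (flip k) w) j = psum (rv_tuple X w) j.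
Proof.
move=> jk; apply: eq_bigr => i ij; rewrite !tnth_mktuple /flip.
by rewrite (leq_trans ij jk).
Qed.

Lemma psum_flip_end k w : psum (rv_tuple (flip k) w) n =
  2 * psum (rv_tuple X w) k - psum (rv_tuple X w) n.
Proof.
have E u : psum (u : n.-tuple R) n = \sum_i tnth u i.
  by apply: eq_bigl => i; rewrite ltn_ord.
rewrite !E /psum (big_mkcond (fun i : 'I_n => (i < k)%N)) /= mulr_sumr -sumrB.
apply: eq_bigr => i _; rewrite !tnth_mktuple /flip /=; case: ifP => _ /=; ring.
Qed.

(** For each [k] the event that the passage takes place at [k] depends only on
increments that [flip k] leaves alone, whereas [flip k] sends the final value to
its mirror image with respect to the value at [k]. Summing over [k] gives the
discrete reflection principle. *)
Lemma passage_reflection h (A : set R) : measurable A ->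
  P [set w | exists k, [/\ (k <= n)%N, passage n h k (rv_tuple X w) &
      A (psum (rv_tuple X w) n)]] =
  P [set w | exists k, [/\ (k <= n)%N, passage n h k (rv_tuple X w) &
      A (2 * psum (rv_tuple X w) k - psum (rv_tuple X w) n)]].
Proof.
move=> mA.
pose E k := passage n h k `&` (fun u => psum u n) @^-1` A.
have mE k : measurable (E k).
  apply: measurableI; first exact: measurable_passage.
  exact: (measurable_preimage (measurable_psum _)).
have mXt := measurable_rv_tuple mX.
have mFt k : measurable_fun setT (rv_tuple (flip k)).
  by apply: measurable_rv_tuple => i; apply: measurableT_comp.
have pf k w : passage n h k (rv_tuple (flip k) w) <-> passage n h k (rv_tuple X w).
  rewrite /passage /= psum_flip//; split => -[hk H]; split => // j jk.
    by rewrite -(psum_flip _ (ltnW jk)) H.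
  by rewrite (psum_flip _ (ltnW jk)) H.
have -> : [set w | exists k, [/\ (k <= n)%N, passage n h k (rv_tuple X w) &
      A (psum (rv_tuple X w) n)]] = \bigcup_(k in `I_n.+1) (rv_tuple X @^-1` E k).
  by apply/seteqP; split=> [w [k [kn pk Ak]]|w [k kn [pk Ak]]]; exists k.
have -> : [set w | exists k, [/\ (k <= n)%N, passage n h k (rv_tuple X w) &
      A (2 * psum (rv_tuple X w) k - psum (rv_tuple X w) n)]] =
    \bigcup_(k in `I_n.+1) (rv_tuple (flip k) @^-1` E k).
  apply/seteqP; split=> [w [k [kn pk Ak]]|w [k kn [pk Ak]]]; exists k => //.
    by split; [exact/pf|rewrite /preimage/= psum_flip_end].
  by split => //; [exact/pf|move: Ak; rewrite /preimage/= psum_flip_end].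
rewrite !measure_fin_bigcup//.
- by apply: eq_fsbigr => k _; exact: flip_law.
- move=> k l _ _ [w [[pk _] [pl _]]].
  by move/pf : pk; move/pf : pl => pl pk; exact: passage_inj pk pl.
- by move=> k _; exact: measurable_preimage.
- by move=> k l _ _ [w [[pk _] [pl _]]]; exact: passage_inj pk pl.
- by move=> k _; exact: measurable_preimage.
Qed.

End walk.

(** * Centred normal laws and dyadic times *)

Section normal.
Context {R : realType}.

(** The density is even and Lebesgue measure is invariant under [-%R]. *)
Lemma normal_probN (s : R) (A : set R) : s != 0 -> measurable A ->
  normal_prob 0 s (-%R @^-1` A) = normal_prob 0 s A.
Proof.
move=> s0 mA; rewrite /normal_prob.
have mf : measurable_fun [set: R] (EFin \o normal_pdf 0 s).
  by apply/measurable_EFinP; exact: measurable_normal_pdf.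
transitivity (\int[pushforward lebesgue_measure (-%R : _ -> measurableTypeR R)]_(x in A)
    (normal_pdf 0 s x)%:E)%E; last first.
  by apply: eq_measure_integral => //= B mB BA; exact: lebesgue_measureN.
rewrite ge0_integral_pushforward//=.
- apply: eq_integral => x _ /=; rewrite !normal_pdfE// /normal_fun.
  by rewrite !subr0 sqrrN.
- exact: measurable_funS mf.
- by move=> x _; rewrite lee_fin normal_pdf_ge0.
Qed.

Lemma normal_prob_set1 (s c : R) : normal_prob 0 s [set c] = 0%E.
Proof.
have /null_content_dominatesP := normal_prob_dominates 0 s; apply => //.
exact: lebesgue_measure_set1.
Qed.

End normal.

Section dyadic.
Context {R : realType}.
Implicit Types (T h : R) (f : R -> R).

Definition dyadic T (n k : nat) : R := T * k%:R / (2 ^ n)%:R.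

Lemma dyadic0 T n : dyadic T n 0 = 0.
Proof. by rewrite /dyadic mulr0 mul0r. Qed.

Lemma dyadicT T n : dyadic T n (2 ^ n) = T.
Proof. by rewrite /dyadic mulfK// pnatr_eq0 expn_eq0. Qed.

Lemma dyadic_in T n k : 0 <= T -> (k <= 2 ^ n)%N -> 0 <= dyadic T n k <= T.
Proof.
move=> T0 kn; rewrite /dyadic divr_ge0 ?mulr_ge0//= ler_pdivrMr ?ltr0n ?expn_gt0//.
by rewrite ler_wpM2l// ler_nat.
Qed.

Lemma dyadicS T n k : dyadic T n.+1 (2 * k) = dyadic T n k.
Proof.
rewrite /dyadic expnS !natrM -mulf_div [_ / _ * _]mulrC.
have n0 : (2 ^ n)%:R != 0 :> R by rewrite pnatr_eq0 expn_eq0.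
by field.
Qed.

Lemma dyadic_sym T n k : (k <= 2 ^ n)%N -> dyadic T n (2 ^ n - k) = T - dyadic T n k.
Proof. by move=> kn; rewrite -{2}(dyadicT T n) /dyadic natrB//; ring. Qed.

Lemma dyadic_step T n k : dyadic T n k.+1 = dyadic T n k + T / (2 ^ n)%:R.
Proof. by rewrite /dyadic -addn1 natrD; ring. Qed.

Lemma dyadic_mesh T d : 0 < d -> exists n0, forall n, (n0 <= n)%N -> T / (2 ^ n)%:R < d.
Proof.
move=> d0; have [T0|T0] := leP T 0.
  exists 0%N => n _; apply: le_lt_trans d0.
  by rewrite mulr_le0_ge0// invr_ge0.
exists (Num.truncn (T / d)).+1 => n ntd.
rewrite ltr_pdivrMr ?ltr0n ?expn_gt0// mulrC -ltr_pdivrMr//.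
apply: lt_le_trans (truncnS_gt _) _; rewrite ler_nat.
by apply: leq_trans ntd _; apply/ltnW/ltn_expl.
Qed.

Lemma dyadic_below T n t : 0 < T -> 0 <= t <= T -> exists2 k, (k <= 2 ^ n)%N &
  dyadic T n k <= t < dyadic T n k + T / (2 ^ n)%:R.
Proof.
move=> T0 /andP[t0 tT].
have N0 : 0 < (2 ^ n)%:R :> R by rewrite ltr0n expn_gt0.
have q0 : 0 <= t * (2 ^ n)%:R / T by rewrite divr_ge0 ?mulr_ge0// ltW.
have /andP[h1 h2] := truncn_itv q0.
exists (Num.truncn (t * (2 ^ n)%:R / T)).
  rewrite -(ler_nat R); apply: le_trans h1 _.
  by rewrite ler_pdivrMr// mulrC ler_wpM2l// ltW.
rewrite -dyadic_step /dyadic ler_pdivrMr// ltr_pdivlMr//.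
by move: h1 h2; rewrite ler_pdivlMr// ltr_pdivrMr// ![T * _]mulrC => -> ->.
Qed.

(** If the path exceeds [h] somewhere it does so on a neighbourhood, which contains
a dyadic time of the interval once the mesh is small. *)
Lemma runmax_le_dyadic T f h : 0 < T -> {within `[0, T], continuous f} ->
  (runmax T f <= h) <-> forall n k, (k <= 2 ^ n)%N -> f (dyadic T n k) <= h.
Proof.
move=> T0 cf; have [[t tT ft] ub] := runmaxP (ltW T0) cf; split.
  by move=> mh n k kn; apply: le_trans mh; exact/ub/dyadic_in/kn/ltW.
move=> H; rewrite -ft leNgt; apply/negP => hft.
have [|d d0 Hd] := within_continuous_lt_near (c := - h) (continuous_within_opp cf) tT.
  by rewrite ltrN2.
have [n0 /(_ _ (leqnn _)) nd] := dyadic_mesh T d0.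
have [k kn tk] := dyadic_below n0 T0 tT.
have := Hd _ (dyadic_in (ltW T0) kn); rewrite ltrN2 ger0_norm; last by lra.
by have := H _ _ kn; lra.
Qed.

Lemma dyadic_le T n j k : 0 <= T -> (j <= k)%N -> dyadic T n j <= dyadic T n k.
Proof.
move=> T0 jk; rewrite /dyadic ler_wpM2r ?invr_ge0//.
by rewrite ler_wpM2l// ler_nat.
Qed.

(** Let [t] be the infimum of the times at which the path is above [h]. A first
dyadic passage comes after [t]; once the mesh is small it also comes shortly
after [t], because right after [t] the path is above [h] on an open set, which
contains a dyadic time. As the path is at most [h] at time [t], its value shortly
after is less than [h + e]. *)
Lemma small_overshoot T f h e : 0 < T -> {within `[0, T], continuous f} ->
  f 0 <= h -> h < runmax T f -> 0 < e ->
  exists n0, forall n, (n0 <= n)%N -> forall k, (k <= 2 ^ n)%N ->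
    h < f (dyadic T n k) -> (forall j, (j < k)%N -> f (dyadic T n j) <= h) ->
    f (dyadic T n k) < h + e.
Proof.
move=> T0 cf f0 hS e0; have [[s0 s0T fs0] _] := runmaxP (ltW T0) cf.
pose A := [set t | 0 <= t <= T /\ h < f t].
have As0 : A s0 by rewrite /A/= s0T fs0.
have lbA : lbound A 0 by move=> t [/andP[]].
have infA : has_inf A by split; [exists s0|exists 0].
have inf_leA t : A t -> inf A <= t by move=> At; apply: ge_inf => //; exists 0.
have inf_ge0 : 0 <= inf A by apply: lb_le_inf => //; exists s0.
have infT : 0 <= inf A <= T by have := inf_leA _ As0; lra.
have finf : f (inf A) <= h.
  rewrite leNgt; apply/negP => hf.
  have [|d d0 Hd] := within_continuous_lt_near (c := - h) (continuous_within_opp cf) infT.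
    by rewrite ltrN2.
  have [d2|d2] := leP (inf A) (d / 2).
    have /Hd : 0 <= (0 : R) <= T by rewrite lexx ltW.
    rewrite subr0 ger0_norm// ltrN2 => hf0; suff : h < f 0 by lra.
    by apply: hf0; lra.
  have AE : A (inf A - d / 2).
    have I0 : 0 <= inf A - d / 2 <= T by lra.
    split => //; have := Hd _ I0; rewrite ltrN2; apply.
    rewrite (_ : _ - _ = d / 2); last by ring.
    by rewrite ger0_norm; lra.
  have := inf_leA _ AE; lra.
have [|d1 d10 H1] := within_continuous_lt_near (c := h + e) cf infT; first by lra.
have [s [sT hs] s1] := inf_adherent d10 infA.
have [|d2 d20 H2] := within_continuous_lt_near (c := - h) (continuous_within_opp cf) sT.
  by rewrite ltrN2.
have [n0 Hn0] := dyadic_mesh T d20; exists n0 => n n0n k kn hk kmin.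
have [k' kn' k's] := dyadic_below n T0 sT.
have hk' : h < f (dyadic T n k').
  have := H2 _ (dyadic_in (ltW T0) kn'); rewrite ltrN2; apply.
  by have := Hn0 _ n0n; rewrite ger0_norm; lra.
have kk' : (k <= k')%N.
  by rewrite leqNgt; apply/negP => /kmin; rewrite leNgt hk'.
have kT := dyadic_in (ltW T0) kn.
apply: H1 => //; have := inf_leA _ (conj kT hk).
have := dyadic_le n (ltW T0) kk'.
by move=> ? ?; rewrite ler0_norm; lra.
Qed.

End dyadic.

(** * Brownian motion on an interval *)

Section brownian_on.
Context d (Om : measurableType d) (R : realType) (P : probability Om R).
Implicit Types (T h x : R) (B : R -> Om -> R) (A : set R).

Definition dyadic_increment T B n (i : 'I_(2 ^ n)) w : R :=
  B (dyadic T n i.+1) w - B (dyadic T n i) w.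

(** Brownian motion on [[0, T]], observed only along the dyadic subdivisions of that
interval. They suffice to determine the law of the endpoint and maximum of a
continuous path, and they are permuted by time reversal on [[0, T]]. *)
Record brownian_on T B : Prop := {
  brownian_on_measurable : forall t, 0 <= t <= T -> measurable_fun setT (B t) ;
  brownian_on_continuous :
    forall w, {within `[0, T], continuous (fun t => B t w)} ;
  brownian_on_start : forall w, B 0 w = 0 ;
  brownian_on_independent :
    forall n, mutually_independent P (@dyadic_increment T B n) ;
  brownian_on_law : forall n (i : 'I_(2 ^ n)) A, measurable A ->
    P (dyadic_increment T B i @^-1` A) =
    normal_prob 0 (Num.sqrt (T / (2 ^ n)%:R)) A
}.

Section facts.
Variables (T : R) (B : R -> Om -> R).
Hypotheses (T0 : 0 < T) (BB : brownian_on T B).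

Let mB := brownian_on_measurable BB.
Let cB := brownian_on_continuous BB.
Lemma measurable_dyadic_increment n (i : 'I_(2 ^ n)) :
  measurable_fun setT (dyadic_increment T B i).
Proof.
by apply: measurable_funB; apply/mB/dyadic_in; rewrite ?(ltW T0)// ltnW.
Qed.

Lemma psum_dyadic n k w : (k <= 2 ^ n)%N ->
  psum (rv_tuple (@dyadic_increment T B n) w) k = B (dyadic T n k) w.
Proof.
move=> kn; rewrite /psum.
under eq_bigr do rewrite tnth_mktuple.
rewrite -(big_ord_widen _ (fun i => B (dyadic T n i.+1) w - B (dyadic T n i) w) kn).
rewrite -(big_mkord xpredT (fun i => B (dyadic T n i.+1) w - B (dyadic T n i) w)).
by rewrite telescope_sumr// dyadic0 (brownian_on_start BB) subr0.
Qed.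

Lemma psum_dyadicT n w :
  psum (rv_tuple (@dyadic_increment T B n) w) (2 ^ n) = B T w.
Proof. by rewrite psum_dyadic// dyadicT. Qed.

Lemma brownian_on_end A : measurable A ->
  P (B T @^-1` A) = normal_prob 0 (Num.sqrt T) A.
Proof.
move=> mA; have := brownian_on_law BB (ord0 : 'I_(2 ^ 0)) mA.
rewrite expn0 divr1 => <-; congr (P _); apply/seteqP.
by split => w; rewrite /preimage/dyadic_increment/= dyadic0 dyadicT
  (brownian_on_start BB) subr0.
Qed.

Lemma runmax_le_bigcap h : [set w | runmax T (B ^~ w) <= h] =
  \bigcap_n \bigcap_(k in `I_(2 ^ n).+1) [set w | B (dyadic T n k) w <= h].
Proof.
apply/seteqP; split => [w /= mh n _ k kn|w H].
  by have /(_ mh n k kn) := (runmax_le_dyadic h T0 (@cB w)).1.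
apply/(runmax_le_dyadic h T0 (@cB w)) => n k kn; exact: (H n I k kn).
Qed.

Lemma measurable_dyadic_le n h k : (k <= 2 ^ n)%N ->
  measurable [set w | B (dyadic T n k) w <= h].
Proof.
move=> kn; rewrite (_ : [set w | _] = B (dyadic T n k) @^-1` `]-oo, h]).
  by apply: measurable_preimage => //; apply/mB/dyadic_in => //; exact: ltW.
by apply/seteqP; split => w; rewrite /= in_itv.
Qed.

Lemma measurable_runmax : measurable_fun setT (fun w => runmax T (B ^~ w)).
Proof.
move=> mD; apply: (measurability _ (RGenOInfty.measurableE R)) => //.
move=> _ [_ [h ->] <-]; rewrite setTI.
rewrite (_ : _ @^-1` _ = ~` [set w | runmax T (B ^~ w) <= h]); last first.
  apply/seteqP; split => w /=; rewrite in_itv/= andbT ltNge => /negP //.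
apply: measurableC; rewrite runmax_le_bigcap; apply: bigcapT_measurable => n.
apply: fin_bigcap_measurable; first exact: finite_II.
by move=> k kn; exact: measurable_dyadic_le.
Qed.

Lemma measurable_runmax_le h : measurable [set w | runmax T (B ^~ w) <= h].
Proof.
rewrite (_ : [set w | _] = (fun w => runmax T (B ^~ w)) @^-1` `]-oo, h]).
  exact: measurable_preimage measurable_runmax _.
by apply/seteqP; split => w; rewrite /= in_itv.
Qed.

End facts.

Section law.
Variables (T : R) (B B' : R -> Om -> R).
Hypotheses (T0 : 0 < T) (BB : brownian_on T B) (BB' : brownian_on T B').

(** The event only depends on the tuple of dyadic increments, whose law does not
depend on the Brownian motion. *)
Lemma runmax_law_dyadic n A h : measurable A ->
  P (B T @^-1` A `&` \bigcap_(k in `I_(2 ^ n).+1) [set w | B (dyadic T n k) w <= h]) =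
  P (B' T @^-1` A `&` \bigcap_(k in `I_(2 ^ n).+1) [set w | B' (dyadic T n k) w <= h]).
Proof.
move=> mA; pose E : set ((2 ^ n).-tuple R) :=
  (fun u => psum u (2 ^ n)) @^-1` A `&`
  \bigcap_(k in `I_(2 ^ n).+1) ((fun u => psum u k) @^-1` `]-oo, h]).
have mE : measurable E.
  apply: measurableI; first exact: (measurable_preimage (measurable_psum _)).
  apply: fin_bigcap_measurable; first exact: finite_II.
  by move=> k _; exact: (measurable_preimage (measurable_psum _)).
have EE C : brownian_on T C -> C T @^-1` A `&`
    \bigcap_(k in `I_(2 ^ n).+1) [set w | C (dyadic T n k) w <= h] =
    rv_tuple (@dyadic_increment T C n) @^-1` E.
  move=> CC; apply/seteqP; split => w [Aw Ew]; split.
  - by rewrite /preimage/= (psum_dyadicT CC).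
  - by move=> k kn /=; rewrite (psum_dyadic CC)//; have := Ew k kn.
  - by move: Aw; rewrite /preimage/= (psum_dyadicT CC).
  - by move=> k kn /=; have := Ew k kn; rewrite /preimage/= (psum_dyadic CC).
rewrite !EE//; apply: tuple_law_eq => //.
- exact: measurable_dyadic_increment.
- exact: measurable_dyadic_increment.
- exact: brownian_on_independent.
- exact: brownian_on_independent.
- by move=> i C mC; rewrite !(@brownian_on_law T).
Qed.

End law.

End brownian_on.

Section events.
Context d (Om : measurableType d) (R : realType) (P : probability Om R).
Implicit Types (F : (set Om)^nat) (c : \bar R).

Lemma prob_bigcup_le F c : (forall n, measurable (F n)) -> nondecreasing_seq F ->
  (forall n, (P (F n) <= c)%E) -> (P (\bigcup_n F n) <= c)%E.
Proof.
move=> mF ndF Fc.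
have cF := nondecreasing_cvg_mu (mu := P) mF (bigcupT_measurable _ mF) ndF.
rewrite -(cvg_lim _ cF)//; apply: lime_le; first by apply/cvg_ex; eexists; exact: cF.
by apply: nearW => n; exact: Fc.
Qed.

Lemma prob_bigcap_ge F c : (forall n, measurable (F n)) -> nonincreasing_seq F ->
  (forall n, (c <= P (F n))%E) -> (c <= P (\bigcap_n F n))%E.
Proof.
move=> mF niF Fc.
have F0 : (P (F 0%N) < +oo)%E by rewrite (le_lt_trans (probability_le1 _ _)) ?ltry.
have cF := nonincreasing_cvg_mu (mu := P) F0 mF (bigcapT_measurable mF) niF.
rewrite -(cvg_lim _ cF)//; apply: lime_ge; first by apply/cvg_ex; eexists; exact: cF.
by apply: nearW => n; exact: Fc.
Qed.

Lemma prob_bigcup_eq F G : (forall n, measurable (F n)) -> nondecreasing_seq F ->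
  (forall n, measurable (G n)) -> nondecreasing_seq G ->
  (forall n, P (F n) = P (G n)) -> P (\bigcup_n F n) = P (\bigcup_n G n).
Proof.
move=> mF ndF mG ndG FG.
have cF := nondecreasing_cvg_mu (mu := P) mF (bigcupT_measurable _ mF) ndF.
have cG := nondecreasing_cvg_mu (mu := P) mG (bigcupT_measurable _ mG) ndG.
have FGE : P \o F = P \o G by apply/funext => n; exact: FG.
by rewrite -(cvg_lim _ cF)// -(cvg_lim _ cG)// FGE.
Qed.

Lemma prob_bigcap_eq F G : (forall n, measurable (F n)) -> nonincreasing_seq F ->
  (forall n, measurable (G n)) -> nonincreasing_seq G ->
  (forall n, P (F n) = P (G n)) -> P (\bigcap_n F n) = P (\bigcap_n G n).
Proof.
move=> mF niF mG niG FG.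
have fin E : measurable E -> (P E < +oo)%E.
  by move=> mE; rewrite (le_lt_trans (probability_le1 _ _)) ?ltry.
have cF := nonincreasing_cvg_mu (mu := P) (fin _ (mF 0%N)) mF (bigcapT_measurable mF) niF.
have cG := nonincreasing_cvg_mu (mu := P) (fin _ (mG 0%N)) mG (bigcapT_measurable mG) niG.
have FGE : P \o F = P \o G by apply/funext => n; exact: FG.
by rewrite -(cvg_lim _ cF)// -(cvg_lim _ cG)// FGE.
Qed.

Lemma prob_split (f g : Om -> bool) : measurable_fun setT f ->
  measurable_fun setT g ->
  P [set w | f w] = (P [set w | f w && g w] + P [set w | f w && ~~ g w])%E.
Proof.
move=> mf mg; rewrite -measureU.
- congr (P _); apply/seteqP; split => w /=; last by case=> /andP[].
  by move=> ->; case: (g w); [left|right].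
- exact/measurable_event/measurable_and.
- by apply: measurable_event; apply: measurable_and => //; exact: measurable_neg.
- by rewrite -subset0 => w [/andP[_ gw] /andP[_]]; rewrite gw.
Qed.

Lemma eq_prob (f g : Om -> bool) : f =1 g -> P [set w | f w] = P [set w | g w].
Proof. by move=> fg; congr (P _); apply/seteqP; split => w; rewrite /= fg. Qed.

Lemma exists_invS_lt (r : R) : 0 < r -> exists n : nat, n.+1%:R^-1 < r.
Proof.
move=> r0; exists (Num.truncn r^-1).
by rewrite -[ltRHS]invrK ltf_pV2 ?posrE ?invr_gt0// truncnS_gt.
Qed.

Lemma invS_le m n : (m <= n)%N -> n.+1%:R^-1 <= m.+1%:R^-1 :> R.
Proof. by move=> mn; rewrite lef_pV2 ?posrE ?ltr0n// ler_nat. Qed.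

End events.

Section joint_law.
Context d (Om : measurableType d) (R : realType) (P : probability Om R).
Variables (T : R) (B B' : R -> Om -> R).
Hypotheses (T0 : 0 < T) (BB : brownian_on P T B) (BB' : brownian_on P T B').

Let TT : 0 <= T <= T. Proof. by rewrite lexx ltW. Qed.

(** Decreasing limit of the events that the dyadic skeleton stays below [h]. *)
Lemma runmax_law_le A h : measurable A ->
  P (B T @^-1` A `&` [set w | runmax T (B ^~ w) <= h]) =
  P (B' T @^-1` A `&` [set w | runmax T (B' ^~ w) <= h]).
Proof.
move=> mA.
have E C : brownian_on P T C -> C T @^-1` A `&` [set w | runmax T (C ^~ w) <= h] =
    \bigcap_n (C T @^-1` A `&`
      \bigcap_(k in `I_(2 ^ n).+1) [set w | C (dyadic T n k) w <= h]).
  by move=> CC; rewrite (runmax_le_bigcap T0 CC) -bigcapIr//; exists 0%N.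
have M C : brownian_on P T C -> forall n, measurable (C T @^-1` A `&`
      \bigcap_(k in `I_(2 ^ n).+1) [set w | C (dyadic T n k) w <= h]).
  move=> CC n; apply: measurableI.
    exact: (measurable_preimage (brownian_on_measurable CC TT)).
  apply: fin_bigcap_measurable; first exact: finite_II.
  by move=> k kn; exact: (measurable_dyadic_le T0 CC).
have N C : nonincreasing_seq (fun n => C T @^-1` A `&`
      \bigcap_(k in `I_(2 ^ n).+1) [set w : Om | C (dyadic T n k) w <= h]).
  apply/nonincreasing_seqP => n; apply/subsetPset => w [Aw Hw]; split => // k kn.
  rewrite /= -dyadicS; apply: Hw; rewrite /= ltnS expnS.
  by rewrite leq_mul2l.
rewrite !E//; apply: prob_bigcap_eq; [exact: M|exact: N|exact: M|exact: N|].
by move=> n; exact: runmax_law_dyadic.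
Qed.

Lemma runmax_law_lt A h : measurable A ->
  P (B T @^-1` A `&` [set w | runmax T (B ^~ w) < h]) =
  P (B' T @^-1` A `&` [set w | runmax T (B' ^~ w) < h]).
Proof.
move=> mA.
have E C : C T @^-1` A `&` [set w : Om | runmax T (C ^~ w) < h] =
    \bigcup_n (C T @^-1` A `&` [set w | runmax T (C ^~ w) <= h - n.+1%:R^-1]).
  apply/seteqP; split => [w [Aw /= Cw]|w [n _ [Aw /= Cw]]].
    have /exists_invS_lt[n hn] : 0 < h - runmax T (C ^~ w) by rewrite subr_gt0.
    by exists n => //; split => //=; rewrite lerBrDr addrC -lerBrDr ltW.
  split => //=; apply: le_lt_trans Cw _.
  by rewrite ltrBlDr ltrDl invr_gt0.
have M C : brownian_on P T C -> forall n : nat, measurable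
    (C T @^-1` A `&` [set w | runmax T (C ^~ w) <= h - n.+1%:R^-1]).
  move=> CC n; apply: measurableI.
    exact: (measurable_preimage (brownian_on_measurable CC TT)).
  exact: (measurable_runmax_le T0 CC).
have N C : nondecreasing_seq (fun n : nat => C T @^-1` A `&`
     [set w : Om | runmax T (C ^~ w) <= h - n.+1%:R^-1]).
  move=> m n mn; apply/subsetPset => w [Aw /= Hw]; split => //=.
  by apply: le_trans Hw _; rewrite lerB// invS_le.
rewrite !E; apply: prob_bigcup_eq; [exact: M|exact: N|exact: M|exact: N|].
by move=> n; exact: runmax_law_le.
Qed.

End joint_law.

(** * The reflection principle *)

Section reflection.
Context d (Om : measurableType d) (R : realType) (P : probability Om R).
Implicit Types (A : set R) (h x : R) (n k : nat).
Variables (T : R) (B : R -> Om -> R).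
Hypotheses (T0 : 0 < T) (BB : brownian_on P T B).

Let TT : 0 <= T <= T. Proof. by rewrite lexx ltW. Qed.
Let mBT : measurable_fun setT (B T). Proof. exact: (brownian_on_measurable BB TT). Qed.

Lemma endpoint_null x : P (B T @^-1` [set x]) = 0%E.
Proof. by rewrite (brownian_on_end BB)// normal_prob_set1. Qed.

Lemma endpoint_law_opp A : measurable A -> P (B T @^-1` (-%R @^-1` A)) = P (B T @^-1` A).
Proof.
move=> mA; rewrite !(brownian_on_end BB)//; last exact: (measurable_preimage (oppr_measurable (D := setT))).
by rewrite normal_probN// gt_eqF// sqrtr_gt0.
Qed.

Definition first_above n h k w := h < B (dyadic T n k) w /\
  forall j, (j < k)%N -> B (dyadic T n j) w <= h.

(** First passage in terms of the process, as opposed to its increments. *)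
Lemma first_above_passage n h k w : (k <= 2 ^ n)%N ->
  first_above n h k w <->
  passage h k (rv_tuple (@dyadic_increment _ _ _ T B n) w).
Proof.
move=> kn; rewrite /first_above /passage/= (psum_dyadic BB)//.
split=> -[hk H]; split => // j jk; have jn := leq_trans (ltnW jk) kn.
  by rewrite (psum_dyadic BB)// H.
by have := H j jk; rewrite (psum_dyadic BB).
Qed.

Lemma first_above_exists n h w m : (m <= 2 ^ n)%N -> h < B (dyadic T n m) w ->
  exists2 k, (k <= m)%N & first_above n h k w.
Proof.
move=> mn hm; have [|k km pk] := @passage_exists _ (2 ^ n) h
    (rv_tuple (@dyadic_increment _ _ _ T B n) w) m.
  by rewrite (psum_dyadic BB).
by exists k => //; apply/first_above_passage => //; exact: leq_trans mn.
Qed.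

Lemma measurable_first_above n h k : (k <= 2 ^ n)%N ->
  measurable [set w | first_above n h k w].
Proof.
move=> kn; rewrite (_ : [set w | _] = rv_tuple (@dyadic_increment _ _ _ T B n) @^-1`
   passage h k).
  apply: measurable_preimage; last exact: measurable_passage.
  by apply: measurable_rv_tuple => i; exact: (measurable_dyadic_increment T0 BB).
by apply/seteqP; split => w /(first_above_passage _ _ kn).
Qed.

Lemma dyadic_reflection n h A : measurable A ->
  P [set w | exists k, [/\ (k <= 2 ^ n)%N, first_above n h k w & A (B T w)]] =
  P [set w | exists k, [/\ (k <= 2 ^ n)%N, first_above n h k w &
      A (2 * B (dyadic T n k) w - B T w)]].
Proof.
move=> mA.
have symX (i : 'I_(2 ^ n)) C : measurable C ->
    P (dyadic_increment T B i @^-1` C) =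
    P ((-%R \o dyadic_increment T B i) @^-1` C).
  move=> mC; rewrite comp_preimage !(brownian_on_law BB)//.
    by rewrite normal_probN// gt_eqF// sqrtr_gt0 divr_gt0// ltr0n expn_gt0.
  exact: (measurable_preimage (oppr_measurable (D := setT))).
have := passage_reflection (measurable_dyadic_increment T0 BB (n := n))
  (brownian_on_independent BB (n := n)) symX h mA.
set L1 := P _; set R1 := P _ => LR.
transitivity L1.
  congr (P _); apply/seteqP; split => w [k [kn fk Ak]]; exists k; split => //.
  - exact/first_above_passage.
  - by rewrite (psum_dyadicT BB).
  - exact/first_above_passage.
  - by move: Ak; rewrite (psum_dyadicT BB).
rewrite LR; congr (P _); apply/seteqP; split => w [k [kn fk Ak]]; exists k; split => //.
- exact/first_above_passage.
- by move: Ak; rewrite (psum_dyadicT BB) (psum_dyadic BB).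
- exact/first_above_passage.
- by rewrite (psum_dyadicT BB) (psum_dyadic BB).
Qed.

Lemma measurable_exists_first_above n h (E : nat -> set Om) :
  (forall k, (k <= 2 ^ n)%N -> measurable (E k)) ->
  measurable [set w | exists k, [/\ (k <= 2 ^ n)%N, first_above n h k w & E k w]].
Proof.
move=> mE; rewrite (_ : [set w | _] = \bigcup_(k in `I_(2 ^ n).+1)
    ([set w | first_above n h k w] `&` E k)).
  apply: fin_bigcup_measurable; first exact: finite_II.
  move=> k kn; apply: measurableI; first exact: measurable_first_above.
  exact: mE.
by apply/seteqP; split => [w [k [kn fk Ek]]|w [k kn [fk Ek]]]; exists k.
Qed.

Lemma runmax_gtE h w : h < runmax T (B ^~ w) <->
  exists n k, (k <= 2 ^ n)%N /\ h < B (dyadic T n k) w.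
Proof.
have cw := @brownian_on_continuous _ _ _ _ _ _ BB w.
split=> [|[n [k [kn hk]]]]; last first.
  rewrite ltNge; apply/negP => /(runmax_le_dyadic h T0 cw)/(_ _ _ kn).
  by rewrite leNgt hk.
rewrite ltNge => /negP; apply: contra_notP => H.
apply/(runmax_le_dyadic h T0 cw) => n k kn; rewrite leNgt; apply/negP => hk.
by apply: H; exists n, k.
Qed.

Lemma measurable_runmax_gt h : measurable [set w | h < runmax T (B ^~ w)].
Proof.
rewrite (_ : [set w | _] = ~` [set w | runmax T (B ^~ w) <= h]).
  exact/measurableC/(measurable_runmax_le T0 BB).
by apply/seteqP; split => w /=; rewrite ltNge => /negP.
Qed.

Lemma measurable_endpoint_le x : measurable [set w | B T w <= x].
Proof.
rewrite (_ : [set w | _] = B T @^-1` `]-oo, x]); first exact: measurable_preimage.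
by apply/seteqP; split => w; rewrite /= in_itv.
Qed.

Lemma measurable_endpoint_gt x : measurable [set w | x < B T w].
Proof.
rewrite (_ : [set w | _] = B T @^-1` `]x, +oo[); first exact: measurable_preimage.
by apply/seteqP; split => w; rewrite /= in_itv/= andbT.
Qed.

(** At a first dyadic passage the process is above [h], so that its mirrored
endpoint is above [2 * h - x] as soon as the endpoint is at most [x]. The events
that the dyadic skeleton exceeds [h] increase to the event that the maximum
does. *)
Lemma reflection_le h x :
  (P [set w | (B T w <= x /\ h < runmax T (B ^~ w))%R] <=
   P [set w | (2 * h - x < B T w)%R])%E.
Proof.
pose F n := [set w | exists k, [/\ (k <= 2 ^ n)%N, first_above n h k w &
  B T w <= x]].
have -> : [set w | B T w <= x /\ h < runmax T (B ^~ w)] = \bigcup_n F n.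
  apply/seteqP; split => [w [wx /runmax_gtE[n [k [kn hk]]]]|w [n _ [k [kn [hk _] wx]]]].
    exists n => //; have [l lk fl] := first_above_exists kn hk.
    by exists l; split => //; exact: leq_trans kn.
  by split => //; apply/runmax_gtE; exists n, k.
apply: prob_bigcup_le.
- move=> n; apply: measurable_exists_first_above => k kn.
  exact: measurable_endpoint_le.
- apply/nondecreasing_seqP => n; apply/subsetPset => w [k [kn [hk _] wx]].
  rewrite -dyadicS in hk; have k2n : (2 * k <= 2 ^ n.+1)%N by rewrite expnS leq_mul2l.
  have [l lk fl] := first_above_exists k2n hk.
  by exists l; split => //; exact: leq_trans k2n.
move=> n; rewrite /F.
have := @dyadic_reflection n h `]-oo, x] (measurable_itv _).
rewrite (_ : [set w | _] = [set w | exists k, [/\ (k <= 2 ^ n)%N,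
    first_above n h k w & B T w <= x]]); last first.
  by apply/seteqP; split => w [k [kn fk wx]]; exists k; split => //;
    move: wx; rewrite /= in_itv.
move=> ->; apply: le_measure; rewrite ?inE.
- apply: measurable_exists_first_above => k kn.
  have kT := dyadic_in (ltW T0) kn.
  apply: (measurable_preimage (f := fun w => 2 * B (dyadic T n k) w - B T w)) => //.
  apply: measurable_funB => //; apply: measurable_funM => //.
  exact: (brownian_on_measurable BB).
- exact: measurable_endpoint_gt.
- by move=> w [k [kn [hk _]]] /=; rewrite in_itv/=; lra.
Qed.

(** An endpoint above [2 * h - x >= h] entails a passage above [h] on every dyadic
subdivision. If the passage overshoots by less than [e], the mirrored endpoint is
at most [x + 2 * e]; and along each path the overshoot is eventually less than
[e]. *)
Lemma reflection_ge h x : 0 <= h -> x <= h ->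
  (P [set w | (2 * h - x < B T w)%R] <=
   P [set w | (B T w <= x /\ h < runmax T (B ^~ w))%R])%E.
Proof.
move=> h0 xh.
pose F m := [set w | B T w <= x + 2 * m.+1%:R^-1 /\ h < runmax T (B ^~ w)].
have -> : [set w | B T w <= x /\ h < runmax T (B ^~ w)] = \bigcap_m F m.
  apply/seteqP; split => [w [wx hw] m _|w Fw].
    by split => //; apply: le_trans wx _; rewrite lerDl mulr_ge0.
  split; last by have [] := Fw 0%N I.
  rewrite leNgt; apply/negP => xw.
  have /exists_invS_lt[m hm] : 0 < (B T w - x) / 2 by lra.
  by case: (Fw m I) hm => + _; move: (_^-1) => e; lra.
apply: prob_bigcap_ge.
- move=> m; apply: measurableI; first exact: measurable_endpoint_le.
  exact: measurable_runmax_gt.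
- move=> m n mn; apply/subsetPset => w [wx hw]; split => //.
  by apply: le_trans wx _; rewrite lerD2l ler_wpM2l// invS_le.
move=> m; set e := m.+1%:R^-1 : R; have e0 : 0 < e by rewrite invr_gt0.
pose G n := [set w | exists k, [/\ (k <= 2 ^ n)%N, first_above n h k w &
  h + e <= B (dyadic T n k) w]].
have mG n : measurable (G n).
  apply: measurable_exists_first_above => k kn.
  have mk : measurable (B (dyadic T n k) @^-1` `[h + e, +oo[).
    apply: measurable_preimage => //; apply: (brownian_on_measurable BB).
    exact: dyadic_in (ltW T0) kn.
  move: mk; congr measurable; apply/seteqP.
  by split => w; rewrite /= in_itv/= andbT.
(* no path overshoots by [e] for infinitely many subdivisions *)
have limG : lim_sup_set G = set0.
  rewrite -subset0 => w limw.
  have [n _ [k0 [k0n [hk0 _] _]]] := limw 0%N I.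
  have cw := @brownian_on_continuous _ _ _ _ _ _ BB w.
  have [||n0 Hn0] := small_overshoot T0 cw (h := h) _ _ e0.
  - by rewrite (brownian_on_start BB).
  - by apply/runmax_gtE; exists n, k0.
  have [n1 /= n01 [k [kn [hk kmin] hek]]] := limw n0 I.
  by have := Hn0 _ n01 _ kn hk kmin; rewrite ltNge hek.
have cG := lim_sup_set_cvg P G mG (le_lt_trans (probability_le1 _
   (bigcup_measurable (fun n _ => mG n))) (ltry _)).
rewrite limG measure0 in cG.
have key n : (P [set w | (2 * h - x < B T w)%R] <=
    P (F m) + P (\bigcup_(k >= n) G k))%E.
  have mUG : measurable (\bigcup_(k >= n) G k) by apply: bigcup_measurable => k _.
  have mF : measurable (F m).
    by apply: measurableI; [exact: measurable_endpoint_le|exact: measurable_runmax_gt].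
  apply: (@le_trans _ _ (P (F m `|` \bigcup_(k >= n) G k))); last first.
    exact: measureU2.
  rewrite (_ : [set w | _] = [set w | exists k, [/\ (k <= 2 ^ n)%N,
      first_above n h k w & `]2 * h - x, +oo[%classic (B T w)]]); last first.
    apply/seteqP; split => w /=; last first.
      by move=> [k [_ _]]; rewrite in_itv/= andbT.
    move=> hw; have /(first_above_exists (leqnn _))[k kn fk] :
        h < B (dyadic T n (2 ^ n)) w by rewrite dyadicT; lra.
    by exists k; split => //; rewrite in_itv/= andbT.
  rewrite dyadic_reflection//; apply: le_measure; rewrite ?inE.
  - apply: measurable_exists_first_above => k kn.
    have kT := dyadic_in (ltW T0) kn.
    apply: (measurable_preimage (f := fun w => 2 * B (dyadic T n k) w - B T w)) => //.
    apply: measurable_funB => //; apply: measurable_funM => //.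
    exact: (brownian_on_measurable BB).
  - exact: measurableU.
  move=> w [k [kn fk]] /=; rewrite in_itv/= andbT => hw.
  have [hek|hek] := leP (h + e) (B (dyadic T n k) w).
    by right; exists n => //=; exists k.
  left; split; first by rewrite -/e; lra.
  by apply/runmax_gtE; exists n, k; split => //; case: fk.
have cG' : (P (F m) + P (\bigcup_(k >= n) G k) @[n --> \oo] --> P (F m) + 0)%E.
  by apply: cvgeD; [exact: fin_num_adde_defl|exact: cvg_cst|exact: cG].
rewrite adde0 in cG'; rewrite -(cvg_lim _ cG')//.
apply: lime_ge; first by apply/cvg_ex; eexists; exact: cG'.
by apply: nearW => n; exact: key.
Qed.

Lemma reflection_gt h x : 0 <= h -> x <= h ->
  P [set w | B T w <= x /\ h < runmax T (B ^~ w)] =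
  P [set w | 2 * h - x < B T w].
Proof.
by move=> h0 xh; apply/eqP; rewrite eq_le reflection_le reflection_ge.
Qed.

Lemma endpoint_law_ge x : P [set w | x <= B T w] = P [set w | x < B T w].
Proof.
rewrite (_ : [set w | x <= B T w] = [set w | x < B T w] `|` (B T @^-1` [set x])).
  transitivity (P [set w | (x < B T w)%R] + P (B T @^-1` [set x]))%E.
    apply: measureU; [exact: measurable_endpoint_gt|exact: measurable_preimage|].
    by rewrite -subset0 => w [/= + wx]; rewrite wx ltxx.
  by rewrite endpoint_null adde0.
apply/seteqP; split => w /=; rewrite le_eqVlt.
  by move=> /predU1P[->|]; [right|left].
by move=> [->|->]; rewrite ?orbT ?eqxx.
Qed.

(** The same with strict and large inequalities exchanged: the upper bound is the limit of
[reflection_le] at the levels below [h], the lower bound is [reflection_gt] up to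
the null event that the endpoint is [x]. *)
Lemma reflection_lt h x : 0 <= h -> x <= h ->
  P [set w | B T w < x /\ h <= runmax T (B ^~ w)] =
  P [set w | 2 * h - x < B T w].
Proof.
move=> h0 xh.
have mlt : measurable [set w | B T w < x].
  rewrite (_ : [set w | _] = B T @^-1` `]-oo, x[); first exact: measurable_preimage.
  by apply/seteqP; split => w; rewrite /= in_itv.
have mge : measurable [set w | h <= runmax T (B ^~ w)].
  rewrite (_ : [set w | _] = (fun w => runmax T (B ^~ w)) @^-1` `[h, +oo[).
    exact: (measurable_preimage (measurable_runmax T0 BB)).
  by apply/seteqP; split => w; rewrite /= in_itv/= andbT.
apply/eqP; rewrite eq_le; apply/andP; split.
  rewrite -endpoint_law_ge.
  rewrite [X in (_ <= P X)%E](_ : _ = \bigcap_n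
      [set w | 2 * (h - n.+1%:R^-1) - x < B T w]); last first.
    apply/seteqP; split => [w /= hw n _ /=|w H /=].
      apply: lt_le_trans hw; rewrite ltrD2r ltr_pM2l// ltrBlDr ltrDl.
      by rewrite invr_gt0.
    rewrite leNgt; apply/negP => wh.
    have /exists_invS_lt[n hn] : 0 < (2 * h - x - B T w) / 2 by lra.
    by have /= := H n I; move: (_^-1) hn => e; lra.
  apply: prob_bigcap_ge.
  - by move=> n; exact: measurable_endpoint_gt.
  - move=> m n mn; apply/subsetPset => w /=; apply: le_lt_trans.
    by rewrite lerD2r ler_wpM2l// lerB// invS_le.
  move=> n; apply: le_trans (reflection_le _ _).
  apply: le_measure; rewrite ?inE.
  - exact: measurableI.
  - by apply: measurableI; [exact: measurable_endpoint_le|exact: measurable_runmax_gt].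
  move=> w [/= wx hw]; split; first exact: ltW.
  by apply: lt_le_trans hw; rewrite ltrBlDr ltrDl invr_gt0.
rewrite -reflection_gt//.
apply: (@le_trans _ _ (P ([set w | B T w < x /\ h <= runmax T (B ^~ w)] `|`
    B T @^-1` [set x]))).
  apply: le_measure; rewrite ?inE.
  - by apply: measurableI; [exact: measurable_endpoint_le|exact: measurable_runmax_gt].
  - by apply: measurableU; [exact: measurableI|exact: measurable_preimage].
  move=> w [/=]; rewrite le_eqVlt => /predU1P[->|wx] hw; first by right.
  by left; split => //; exact: ltW.
apply: (@le_trans _ _ (P [set w | (B T w < x /\ h <= runmax T (B ^~ w))%R] +
    P (B T @^-1` [set x])))%E.
  by apply: measureU2; [exact: measurableI|exact: measurable_preimage].
by rewrite endpoint_null adde0.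
Qed.

End reflection.

(** * Reversed and opposite Brownian motion *)

Section reversal.
Context d (Om : measurableType d) (R : realType) (P : probability Om R).
Variable T : R.
Hypothesis T0 : 0 < T.

Lemma standard_brownian_on (W : R -> {RV P >-> R}) :
  standard_brownian_motion W -> brownian_on P T (fun t w => W t w).
Proof.
move=> BW; split.
- by move=> t _; exact: measurable_funPT.
- move=> w; apply: continuous_subspaceW (@brownian_continuous _ _ _ _ _ BW w) => t /=.
  by rewrite !in_itv/= andbT => /andP[].
- exact: brownian_start BW.
- move=> n; apply: (brownian_independent BW (t := dyadic T n)).
    by rewrite dyadic0.
  by move=> i j; apply: dyadic_le; exact: ltW.
- move=> n i A mA; have step : 0 < T / (2 ^ n)%:R by rewrite divr_gt0// ltr0n expn_gt0.
  have i0 : 0 <= dyadic T n i.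
    by have /andP[] := dyadic_in (ltW T0) (ltnW (ltn_ord i)).
  have lti : dyadic T n i < dyadic T n i.+1 by rewrite dyadic_step ltrDl.
  have := brownian_increment BW i0 lti mA.
  rewrite (_ : dyadic T n i.+1 - dyadic T n i = T / (2 ^ n)%:R); first by [].
  by rewrite dyadic_step; ring.
Qed.

Variable B : R -> Om -> R.
Hypothesis BB : brownian_on P T B.

(** The dyadic increments of the reversed process are those of [B] in the reverse
order. *)
Lemma reversed_brownian_on :
  brownian_on P T (fun t w => reversed_increment T (B ^~ w) t).
Proof.
have TT : 0 <= T <= T by rewrite lexx ltW.
have incE n (i : 'I_(2 ^ n)) :
    dyadic_increment T (fun t w => reversed_increment T (B ^~ w) t) i =
    dyadic_increment T B (rev_ord i).
  apply/funext => w; rewrite /dyadic_increment /reversed_increment.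
  have -> : (rev_ord i).+1 = (2 ^ n - i)%N by rewrite /= subnSK.
  rewrite /= !dyadic_sym//; [by ring|exact: ltnW].
split.
- move=> t tT; apply: measurable_funB; apply: (brownian_on_measurable BB) => //.
  by lra.
- move=> w; apply: continuous_reversed_increment.
  exact: (brownian_on_continuous BB).
- by move=> w; rewrite /reversed_increment subr0 subrr.
- move=> n B' mB'; under eq_bigcapr do rewrite incE.
  under eq_bigr do rewrite incE.
  have := mutually_independent_reindex (@rev_ordK _) (brownian_on_independent BB (n := n)).
  exact.
- by move=> n i A mA; rewrite incE (brownian_on_law BB).
Qed.

Lemma opp_brownian_on : brownian_on P T (fun t w => - B t w).
Proof.
have incE n (i : 'I_(2 ^ n)) :
    dyadic_increment T (fun t w => - B t w) i = -%R \o dyadic_increment T B i.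
  by apply/funext => w; rewrite /dyadic_increment /=; ring.
split.
- by move=> t tT; apply: measurableT_comp => //; exact: (brownian_on_measurable BB).
- by move=> w; apply: continuous_within_opp; exact: (brownian_on_continuous BB).
- by move=> w; rewrite (brownian_on_start BB) oppr0.
- move=> n B' mB'; under eq_bigcapr do rewrite incE.
  under eq_bigr do rewrite incE.
  have := mutually_independent_comp (g := fun=> -%R) _ (brownian_on_independent BB (n := n)).
  by apply=> // i; exact: oppr_measurable.
- move=> n i A mA; rewrite incE comp_preimage (brownian_on_law BB).
    by rewrite normal_probN// gt_eqF// sqrtr_gt0 divr_gt0// ltr0n expn_gt0.
  exact: (measurable_preimage (oppr_measurable (D := setT))).
Qed.

End reversal.

(** * The law of the surviving endpoint *)

Section killed_law.
Context d (Om : measurableType d) (R : realType) (P : probability Om R).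
Variables (T : R) (B : R -> Om -> R).
Hypotheses (T0 : 0 < T) (BB : brownian_on P T B).
Variables (a b : R).
Hypothesis b0 : 0 < b.

Let TT : 0 <= T <= T. Proof. by rewrite lexx ltW. Qed.

Let v w := B T w.
Let S w := runmax T (B ^~ w).
Let rho t w := reversed_increment T (B ^~ w) t.
Let rhomax w := runmax T (rho ^~ w).
Let alive w := survives a b T (B ^~ w).
Let e w := endpoint a (S w) (v w).

Let rhoB : brownian_on P T rho. Proof. exact: reversed_brownian_on. Qed.
Let NrhoB : brownian_on P T (fun t w => - rho t w).
Proof. exact: opp_brownian_on. Qed.

Let cB w : {within `[0, T], continuous (B ^~ w)}.
Proof. exact: (@brownian_on_continuous _ _ _ _ _ _ BB w). Qed.

Let S_ge0 w : 0 <= S w.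
Proof.
have [_ ub] := runmaxP (ltW T0) (@cB w).
by rewrite -(brownian_on_start BB w) ub// lexx ltW.
Qed.

Let v_leS w : v w <= S w.
Proof. by have [_ ub] := runmaxP (ltW T0) (@cB w); rewrite ub. Qed.

Let rhoT w : rho T w = v w.
Proof. by rewrite /rho /reversed_increment subrr (brownian_on_start BB) subr0. Qed.

Let Nrhomax w : runmax T (fun t => - rho t w) = S w - v w.
Proof. exact: (runmax_reversed_incrementN (ltW T0) (@cB w)). Qed.

Let mv : measurable_fun setT v. Proof. exact: (brownian_on_measurable BB TT). Qed.
Let mS : measurable_fun setT S. Proof. exact: (measurable_runmax T0 BB). Qed.
Let mrhomax : measurable_fun setT rhomax.
Proof. exact: (measurable_runmax T0 rhoB). Qed.

Lemma measurable_survives : measurable_fun setT alive.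
Proof.
apply: measurable_fun_ifT; first exact: measurable_fun_ltr.
  exact: measurable_fun_ltr.
apply: measurable_or; apply: measurable_fun_ltr => //.
exact: measurable_funB.
Qed.

Lemma measurable_endpoint : measurable_fun setT e.
Proof.
apply: measurable_fun_ifT => //; first exact: measurable_fun_ltr.
apply: measurable_minr; first exact: measurableT_comp.
by apply: measurable_funB => //; exact: measurable_funM.
Qed.

Lemma prob_end_lt r : P [set w | v w < r] = P [set w | - r < v w].
Proof.
have := endpoint_law_opp T0 BB (measurable_itv `]-r, +oo[).
rewrite (_ : B T @^-1` _ = [set w | v w < r]); last first.
  by apply/seteqP; split => w; rewrite /preimage/= in_itv/= andbT ltrN2.
by move=> ->; congr (P _); apply/seteqP; split => w; rewrite /preimage/= in_itv/= andbT.
Qed.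

Lemma reflection_gt_event h x : 0 <= h -> x <= h ->
  P [set w | (v w <= x) && (h < S w)] = P [set w | 2 * h - x < v w].
Proof.
move=> h0 xh; rewrite -(reflection_gt T0 BB h0 xh); congr (P _).
by apply/seteqP; split => w /= /andP.
Qed.

Lemma reflection_lt_event h x : 0 <= h -> x <= h ->
  P [set w | (v w < x) && (h <= S w)] = P [set w | 2 * h - x < v w].
Proof.
move=> h0 xh; rewrite -(reflection_lt T0 BB h0 xh); congr (P _).
by apply/seteqP; split => w /= /andP.
Qed.

Ltac meas := repeat first
 [ exact: mv | exact: mS | exact: mrhomax | exact: measurable_survives | exact: measurable_endpoint
 | exact: measurable_cst | apply: measurable_and | apply: measurable_or
 | apply: measurable_neg | apply: measurable_fun_ltr | apply: measurable_fun_ler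
 | apply: measurable_funB | apply: measurable_funM
 | (apply: measurableT_comp; first exact: oppr_measurable) ].

Let e_low w : v w <= a -> e w = Num.min (- v w) (a - 2 * S w).
Proof. by move=> va; rewrite /e /endpoint ltNge va. Qed.

Let e_high w : a < v w -> e w = v w.
Proof. by move=> va; rewrite /e /endpoint va. Qed.

Let alive_low w : v w <= a -> alive w = (S w - v w < b) || (a - 2 * b < v w).
Proof. by move=> va; rewrite /alive /survives -/(v w) -/(S w) [a < v w]ltNge va. Qed.

Let alive_high w : a < v w -> alive w = (rhomax w < b).
Proof. by move=> va; rewrite /alive /survives -/(v w) va. Qed.

Let e_lt w r : v w <= a -> (e w < r) = (- r < v w) || ((a - r) / 2 < S w).
Proof.
move=> va; rewrite e_low// gt_min; congr (_ || _); first by rewrite ltrNl.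
by apply/idP/idP; lra.
Qed.

(** When [v <= a], the endpoint is below [r] if and only if [- r < v] or
[(a - r) / 2 < S]. If [a < - r] only the second can happen; otherwise the
event splits along the first, and the reflection principle gives the rest the
probability of [a < v]. Either way the total is the probability that [- r < v],
which is that of [v < r] by symmetry. *)
Lemma endpoint_lt_below r : r <= a ->
  P [set w | (v w <= a) && (e w < r)] = P [set w | v w < r].
Proof.
move=> ra; rewrite prob_end_lt.
have [rNa|aNr] := leP (- r) a; last first.
  rewrite -[- r](_ : 2 * ((a - r) / 2) - a = - r); last by lra.
  rewrite -reflection_gt_event; [|lra|lra]; apply: eq_prob => w.
  apply: andb_id2l => va; rewrite e_lt//.
  by rewrite (_ : (- r < v w) = false)//; apply/negbTE; rewrite -leNgt; lra.
rewrite (@prob_split _ _ _ P _ (fun w => - r < v w)); [|meas|meas].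
rewrite [RHS](@prob_split _ _ _ P _ (fun w => v w <= a)); [|meas|meas].
congr (_ + _)%E.
  apply: eq_prob => w; rewrite [RHS]andbC -andbA; apply: andb_id2l => va.
  by rewrite e_lt//; case: (- r < v w); rewrite ?andbF.
rewrite [RHS](_ : _ = P [set w | a < v w]); last first.
  by apply: eq_prob => w; rewrite -ltNge; apply/andP/idP => [[]|va]; [|split]; lra.
rewrite -[in RHS](_ : 2 * ((a - r) / 2) - (- r) = a); last by lra.
rewrite -reflection_gt_event; [|lra|lra]; apply: eq_prob => w.
rewrite -leNgt andbC; apply: andb_id2l => vr.
have va : v w <= a by lra.
by rewrite va e_lt//= ltNge vr.
Qed.

(** By [endpoint_lt_below] it suffices to compare the probabilities of not surviving.
Both are the probability that [2 * b - r < v]: on the left, not surviving with an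
endpoint below [r] means [v <= a - 2 * b] and [(a - r) / 2 < S]. *)
Lemma survives_below r : r <= a -> r <= 2 * b - a ->
  P [set w | alive w && (e w < r)] = P [set w | (v w < r) && (S w < b)].
Proof.
move=> ra rb; have b_gt0 := b0.
have U := endpoint_lt_below ra.
rewrite (@prob_split _ _ _ P _ alive) in U; [|meas|meas].
rewrite [in RHS](@prob_split _ _ _ P _ (fun w => S w < b)) in U; [|meas|meas].
have D : P [set w | (v w <= a) && (e w < r) && ~~ alive w] =
    P [set w | (v w < r) && ~~ (S w < b)].
  transitivity (P [set w | 2 * b - r < v w]); last first.
    rewrite -(@reflection_lt_event b r); [|exact: ltW|lra].
    by apply: eq_prob => w; rewrite -leNgt.
  rewrite -[2 * b - r](_ : 2 * ((a - r) / 2) - (a - 2 * b) = 2 * b - r); last by lra.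
  rewrite -reflection_gt_event; [|lra|lra]; apply: eq_prob => w.
  have [va|av] := leP (v w) a; last first.
    by apply/esym/negP => /andP[h _]; lra.
  rewrite e_lt// alive_low//= negb_or -!leNgt.
  apply/andP/andP => [[/orP h /andP[h1 h2]]|[h1 h2]].
    by split => //; case: h => //; lra.
  by split; [rewrite h2 orbT|apply/andP; split; lra].
rewrite D in U.
have fD : P [set w | (v w < r) && ~~ (S w < b)] \is a fin_num.
  by apply/fin_num_measure/measurable_event; meas.
rewrite (@eq_prob _ _ _ P (fun w => alive w && (e w < r))
  (fun w => (v w <= a) && (e w < r) && alive w)); last first.
  move=> w; rewrite andbC; congr (_ && _).
  have [//|av] := leP (v w) a; rewrite e_high//.
  by apply/negbTE; rewrite -leNgt; lra.
by rewrite -[LHS](addeK _ fD) U addeK.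
Qed.

Lemma runmax_law_event B1 (c : R -> bool) : brownian_on P T B1 ->
  measurable_fun setT c ->
  P [set w | c (B1 T w) && (runmax T (B1 ^~ w) < b)] =
  P [set w | c (v w) && (S w < b)].
Proof.
move=> BB1 mc.
have mC : measurable [set x | c x] by exact: measurable_event.
have := runmax_law_lt T0 BB1 BB b mC.
have E C : C T @^-1` [set x | c x] `&` [set w : Om | runmax T (C ^~ w) < b] =
    [set w | c (C T w) && (runmax T (C ^~ w) < b)].
  by apply/seteqP; split => w /=; [case=> -> ->|move/andP].
by rewrite !E.
Qed.

(** There [Theta] is [rho], a Brownian motion. *)
Lemma survives_high (c : R -> bool) : measurable_fun setT c ->
  P [set w | alive w && c (e w) && (a < v w)] =
  P [set w | c (v w) && (S w < b) && (a < v w)].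
Proof.
move=> mc; have mc' : measurable_fun setT (fun x => c x && (a < x)).
  by apply: measurable_and => //; apply: measurable_fun_ltr.
have := runmax_law_event rhoB mc'.
rewrite (@eq_prob _ _ _ P (fun w => _ && (runmax _ _ < b))
  (fun w => alive w && c (e w) && (a < v w))); last first.
  move=> w /=; rewrite rhoT; have [av|va] := ltP a (v w).
    by rewrite alive_high// e_high// !andbT andbC.
  by rewrite !andbF.
move=> ->; apply: eq_prob => w.
by rewrite -!andbA [(_ < v w) && _]andbC.
Qed.

Let slice (r1 r x : R) : bool := (r1 <= x) && (x < r).

Let mslice r1 r : measurable_fun setT (slice r1 r).
Proof. by apply: measurable_and; [apply: measurable_fun_ler|apply: measurable_fun_ltr]. Qed.

(** An endpoint of [Theta] above [2 * b - a] forces [v <= a - 2 * b], so that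
survival means [S - v < b]; then [2 * S - v <= a], that is, [L] vanishes and
[Theta] ends where [- rho], a Brownian motion, does. *)
Lemma survives_middle r : 2 * b - a <= a ->
  P [set w | alive w && slice (2 * b - a) r (e w) && (v w <= a)] =
  P [set w | slice (2 * b - a) r (v w) && (S w < b) && (v w <= a)].
Proof.
move=> ba; have b_gt0 := b0.
have mc' : measurable_fun setT (fun x => slice (2 * b - a) r x && (x <= a)).
  by apply: measurable_and; [exact: mslice|apply: measurable_fun_ler].
have := runmax_law_event NrhoB mc'.
rewrite (@eq_prob _ _ _ P (fun w => _ && (runmax _ _ < b))
  (fun w => alive w && slice (2 * b - a) r (e w) && (v w <= a))); last first.
  move=> w /=; rewrite rhoT Nrhomax.
  have S0 := S_ge0 w; have vS := v_leS w.
  apply/idP/idP => [/andP[/andP[/andP[h1 h2] h3] h4]|/andP[/andP[h1 h2] va]].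
    have va : v w <= a by lra.
    rewrite va andbT alive_low// h4/= e_low// min_l; last by lra.
    by rewrite /slice h1.
  move: h1 h2; rewrite alive_low// e_low// /slice le_min => h1 /andP[/andP[h2 h3] h4].
  have h5 : S w - v w < b by case/orP: h1 => //; lra.
  rewrite min_l in h4; last by lra.
  by rewrite h5 h2 h4 andbT /=; lra.
move=> ->; apply: eq_prob => w.
by rewrite -!andbA [(_ <= a) && _]andbC.
Qed.

(** The reflection principle at level [0]: almost surely a Brownian motion that ends
at or below [0] has been above [0]. *)
Lemma runmax_le0_null : P [set w | (v w <= 0) && (S w <= 0)] = 0%E.
Proof.
have := @prob_split _ _ _ P (fun w => v w <= 0) (fun w => 0 < S w).
rewrite reflection_gt_event//.
have -> : P [set w | v w <= 0] = P [set w | 2 * 0 - 0 < v w].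
  have := endpoint_law_opp T0 BB (measurable_itv `[0, +oo[).
  rewrite (_ : B T @^-1` (-%R @^-1` _) = [set w | v w <= 0]); last first.
    by apply/seteqP; split => w; rewrite /preimage/= in_itv/= andbT oppr_ge0.
  move=> ->; rewrite mulr0 subr0 -(endpoint_law_ge T0 BB); congr (P _).
  by apply/seteqP; split => w; rewrite /preimage/= in_itv/= andbT.
move=> H; have {}H := H ltac:(meas) ltac:(meas).
have fE : P [set w | 2 * 0 - 0 < v w] \is a fin_num.
  by apply/fin_num_measure/measurable_event; meas.
rewrite (@eq_prob _ _ _ P (fun w => (v w <= 0) && (S w <= 0))
  (fun w => (v w <= 0) && ~~ (0 < S w))); last by move=> w; rewrite -leNgt.
move: H; rewrite addeC => H.
by rewrite -[LHS](addeK _ fE) -H subee.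
Qed.

(** With [v <= a], an endpoint of [Theta] that is at least [a] has to equal [a],
with [S = 0]; both sides are null. *)
Lemma survives_degenerate r : a < 2 * b - a ->
  P [set w | alive w && slice a r (e w) && (v w <= a)] =
  P [set w | slice a r (v w) && (S w < b) && (v w <= a)].
Proof.
move=> ba.
have mce : measurable_fun setT (fun w => slice a r (e w)).
  by apply: (measurableT_comp (@mslice a r) measurable_endpoint).
have mcv : measurable_fun setT (fun w => slice a r (v w)).
  by apply: (measurableT_comp (@mslice a r) mv).
transitivity (0%E : \bar R).
  apply: (subset_measure0 _ _ _ runmax_le0_null).
  - by apply: measurable_event; apply: measurable_and; [apply: measurable_and => //; exact: measurable_survives|meas].
  - by apply: measurable_event; meas.
  move=> w /= /andP[/andP[_ +] va]; rewrite /slice e_low// le_min.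
  move=> /andP[/andP[h1 h2] _]; have := v_leS w; have := S_ge0 w.
  by move=> ? ?; apply/andP; split; lra.
apply/esym; apply: (subset_measure0 _ _ _ (endpoint_null BB a)).
- by apply: measurable_event; apply: measurable_and; [apply: measurable_and => //; meas|meas].
- exact: measurable_preimage.
move=> w /= /andP[/andP[/andP[av _] _] va].
by apply/eqP; rewrite eq_le va av.
Qed.

(** Half-lines below both [a] and [2 * b - a] are [survives_below]; beyond, what is
added to the half-line is cut at [a]. *)
Lemma survives_lt r :
  P [set w | alive w && (e w < r)] = P [set w | (v w < r) && (S w < b)].
Proof.
pose r1 := Num.min a (2 * b - a).
have r1a : r1 <= a by rewrite /r1 ge_min lexx.
have r1b : r1 <= 2 * b - a by rewrite /r1 ge_min lexx orbT.
have [rr1|r1r] := leP r r1.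
  by apply: survives_below; [exact: le_trans r1a|exact: le_trans r1b].
have mce : measurable_fun setT (fun w => slice r1 r (e w)).
  by apply: (measurableT_comp (@mslice r1 r) measurable_endpoint).
have mcv : measurable_fun setT (fun w => slice r1 r (v w)).
  by apply: (measurableT_comp (@mslice r1 r) mv).
rewrite (@prob_split _ _ _ P _ (fun w => e w < r1)); [|meas|meas].
rewrite [RHS](@prob_split _ _ _ P _ (fun w => v w < r1)); [|meas|meas].
congr (_ + _)%E.
  have := survives_below r1a r1b.
  rewrite (@eq_prob _ _ _ P (fun w => alive w && (e w < r1))
    (fun w => alive w && (e w < r) && (e w < r1))); last first.
    move=> w; rewrite -andbA; congr (_ && _).
    by apply/idP/andP => [h|[]//]; split => //; exact: lt_trans r1r.
  move=> ->; apply: eq_prob => w; rewrite andbAC; congr (_ && _).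
  by apply/idP/andP => [h|[]//]; split => //; exact: lt_trans r1r.
rewrite (@eq_prob _ _ _ P (fun w => alive w && (e w < r) && ~~ (e w < r1))
  (fun w => alive w && slice r1 r (e w))); last first.
  by move=> w; rewrite /slice -leNgt -andbA [(_ < r) && _]andbC.
rewrite (@eq_prob _ _ _ P (fun w => (v w < r) && (S w < b) && ~~ (v w < r1))
  (fun w => slice r1 r (v w) && (S w < b))); last first.
  by move=> w; rewrite /slice -leNgt andbAC [(_ < r) && _]andbC.
have m1 : measurable_fun setT (fun w => alive w && slice r1 r (e w)).
  by apply: measurable_and => //; exact: measurable_survives.
have m2 : measurable_fun setT (fun w => slice r1 r (v w) && (S w < b)).
  by apply: measurable_and => //; meas.
rewrite (@prob_split _ _ _ P _ (fun w => a < v w)) //; last by meas.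
rewrite [RHS](@prob_split _ _ _ P _ (fun w => a < v w)) //; last by meas.
congr (_ + _)%E; first exact: survives_high.
rewrite (@eq_prob _ _ _ P (fun w => alive w && slice r1 r (e w) && ~~ (a < v w))
  (fun w => alive w && slice r1 r (e w) && (v w <= a))); last by move=> w; rewrite -leNgt.
rewrite (@eq_prob _ _ _ P (fun w => slice r1 r (v w) && (S w < b) && ~~ (a < v w))
  (fun w => slice r1 r (v w) && (S w < b) && (v w <= a))); last by move=> w; rewrite -leNgt.
rewrite /r1; have [ab|ba] := ltP a (2 * b - a); first exact: survives_degenerate.
exact: survives_middle.
Qed.

Lemma killed_endpoint_law A : measurable A ->
  P [set w | alive w /\ A (e w)] = P [set w | S w < b /\ A (v w)].
Proof.
have m_alive : measurable [set w | alive w] by apply: measurable_event; meas.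
have m_Sb : measurable [set w | S w < b] by apply: measurable_event; meas.
pose fe : {mfun Om >-> R} := mfun_Sub (mem_set measurable_endpoint).
pose fv : {mfun Om >-> R} := mfun_Sub (mem_set mv).
move=> mA.
have E1 C : pushforward (mrestr P m_alive) fe C = P [set w | alive w /\ C (e w)].
  by rewrite /pushforward /mrestr; congr (P _); apply/seteqP; split => w [].
have E2 C : pushforward (mrestr P m_Sb) fv C = P [set w | S w < b /\ C (v w)].
  by rewrite /pushforward /mrestr; congr (P _); apply/seteqP; split => w [].
rewrite -E1 -E2.
have mG : @measurable _ R = <<s @RGenInftyO.G R >> by exact: RGenInftyO.measurableE.
pose g (n : nat) : set R := `]-oo, (n%:R : R)[%classic.
apply: (measure_unique _ g mG
  _ _ _ (pushforward (mrestr P m_alive) fe) (pushforward (mrestr P m_Sb) fv)) => //.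
- move=> _ _ [x ->] [y ->]; exists (Num.min x y).
  by apply/seteqP; split => u; rewrite /= !in_itv/= lt_min => /andP.
- by move=> n; exists n%:R.
- rewrite -subTset => u _; exists (Num.truncn `|u|).+1 => //=.
  by rewrite /g/= in_itv/= (le_lt_trans (ler_norm _) (truncnS_gt _)).
- move=> _ [x ->]; transitivity (P [set w | alive w && (e w < x)]).
    rewrite [LHS]E1; congr (P _).
    by apply/seteqP; split => w /=; rewrite in_itv/=; [case=> -> ->|move/andP].
  rewrite survives_lt; rewrite [RHS]E2.
  congr (P _); apply/seteqP.
  by split => w /=; rewrite in_itv/=; [move/andP => []|case=> -> ->].
- move=> n; apply: (@le_lt_trans _ _ 1%E); last exact: ltry.
  by apply: probability_le1; apply: measurableI => //; exact: (measurable_preimage measurable_endpoint (measurable_itv _)).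
Qed.

End killed_law.

(** * Killed random elements and the duality theorem *)

Section killed.
Context d d' (Om : measurableType d) (E : measurableType d') (R : realType).
Variable P : probability Om R.
Implicit Types (s : Om -> bool) (g : Om -> E) (A : set E).

Definition killed (s : Om -> bool) (g : Om -> E) w : option E :=
  if s w then Some (g w) else None.

Lemma preimage_killed s g (C : set (option E)) :
  killed s g @^-1` C = [set w | s w /\ (Some @^-1` C) (g w)] `|`
    (if `[< C None >] then [set w | ~~ s w] else set0).
Proof.
apply/seteqP; split => w; rewrite /killed /preimage/=.
  by case: ifP => sw Cw; [left|right; rewrite asboolT//= sw].
by move=> [[-> //]|]; case: asboolP => // CN /= /negbTE ->.
Qed.

Lemma measurable_alive_in s g A : measurable_fun setT s -> measurable_fun setT g ->
  measurable A -> measurable [set w : Om | s w /\ A (g w : E)].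
Proof.
move=> ms mg mA; apply: measurableI; first exact: measurable_event.
exact: measurable_preimage.
Qed.

Lemma measurable_killed s g : measurable_fun setT s -> measurable_fun setT g ->
  measurable_fun setT (killed s g).
Proof.
move=> ms mg _ C mC; rewrite setTI preimage_killed; apply: measurableU.
  exact: measurable_alive_in.
by case: ifP => // _; apply: measurable_event; exact: measurable_neg.
Qed.

(** The mass of the coffin state is what survival leaves, so that it is enough to
compare the laws on survival. *)
Lemma same_distribution_killed s s' g g' :
  measurable_fun setT s -> measurable_fun setT g ->
  measurable_fun setT s' -> measurable_fun setT g' ->
  (forall A, measurable A ->
    P [set w | s w /\ A (g w)] = P [set w | s' w /\ A (g' w)]) ->
  same_distribution P (killed s g) (killed s' g').
Proof.
move=> ms mg ms' mg' H; split; [exact: measurable_killed..|move=> C mC].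
have PK u h : measurable_fun setT u -> measurable_fun setT h ->
    P (killed u h @^-1` C) = (P [set w | u w /\ (Some @^-1` C) (h w)] +
      if `[< C None >] then (1 - P [set w | u w /\ setT (h w)]) else 0)%E.
  move=> mu mh; have mU : measurable [set w | ~~ u w].
    by apply: measurable_event; exact: measurable_neg.
  rewrite preimage_killed; case: ifP => _; last by rewrite setU0 adde0.
  transitivity (P [set w | u w /\ (Some @^-1` C) (h w)] + P [set w | ~~ u w])%E.
    apply: measureU => //; first exact: measurable_alive_in.
    by rewrite -subset0 => w [[/= uw _]]; rewrite uw.
  congr (_ + _)%E; rewrite -probability_setC; last exact: measurable_alive_in.
  by congr (P _); apply/seteqP; split => w /=;
    [move=> /negP nu []|move=> H1; apply/negP => uw; exact: H1].
by rewrite /pushforward !PK// !H.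
Qed.

End killed.

Unset Implicit Arguments.

Theorem theorem1p3 (R : realType) (mu T : R) (xs : R * R)
    (T_gt0 : 0 < T) (xsD : Dstar xs) :
  (forall X : R -> R, {within `[0, T], continuous X} ->
     Gamma (Some xs) (X 0) = Gamma (Psi mu T xs X) (X T)) /\
  (forall (d : measure_display) (Om : measurableType d) (P : probability Om R)
      (W : R -> {RV P >-> R}) (x : R),
     standard_brownian_motion W ->
     same_distribution P
       (fun w => Psi mu T xs (time_reversal T (Xhat mu x (fun s => W s w))))
       (fun w => Xstar mu xs (fun s => W s w) T)).
Proof.
split; first by move=> X; exact: Gamma_Psi.
move=> d Om P W x BW; case: xs xsD => z y; rewrite /Dstar/= => zy.
have BB := standard_brownian_on T_gt0 BW.
have cW w : {within `[0, T], continuous (fun t => W t w)}.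
  exact: (@brownian_on_continuous _ _ _ _ _ _ BB w).
have W0 w := brownian_start BW w.
set a := y - x + mu * T; set b := (y - z) / 2.
have b0 : 0 < b by rewrite /b; lra.
pose f (r : R) := (z + mu * T + r, y + mu * T - r).
have mf : measurable_fun setT f.
  by apply: measurable_fun_pair; [apply: measurable_funD|apply: measurable_funB].
rewrite (_ : (fun w => Psi _ _ _ _) = killed
    (fun w => survives a b T (fun t => W t w))
    (f \o fun w => endpoint a (runmax T (fun t => W t w)) (W T w))); last first.
  by apply/funext => w; rewrite (PsiE mu x (ltW T_gt0) zy (@cW w) (W0 w)).
rewrite (_ : (fun w => Xstar _ _ _ _) = killed
    (fun w => runmax T (fun t => W t w) < b) (f \o W T)); last first.
  apply/funext => w; rewrite (XstarE mu (ltW T_gt0) zy _ (W0 w))//.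
  exact: (@brownian_continuous _ _ _ _ _ BW w).
apply: same_distribution_killed.
- exact: (measurable_survives T_gt0 BB).
- by apply: measurableT_comp => //; exact: (measurable_endpoint T_gt0 BB).
- by apply: measurable_fun_ltr => //; exact: (measurable_runmax T_gt0 BB).
- by apply: measurableT_comp => //; exact: measurable_funPT.
- move=> A mA; have mfA := measurable_preimage mf mA.
  exact: (killed_endpoint_law T_gt0 BB a b0 mfA).
Qed.
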